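(* Let $\delta>0$ and let $(A,B,(0,\delta))$ be a skew-adjoint discrete-spectrum control system on a complex Hilbert space $\mathscr{H}$, with $(\phi_n)_{n\in\mathbf{N}}$ the associated orthonormal basis of eigenvectors of $A$ and $A\phi_n=i\lambda_n\phi_n$, $\lambda_n\in\mathbf{R}$. If the elements of the sequence $(\lambda_{n+1}-\lambda_n)_{n\in\mathbf{N}}$ are $\mathbf{Q}$-linearly independent and if $\langle B\phi_n,\phi_{n+1}\rangle\neq 0$ for every $n\in\mathbf{N}$, then $(A,B,(0,\delta))$ is approximately controllable.
   Context: $\mathbf{N}$ is the set of strictly positive integers. Let $\mathscr{H}$ be a complex Hilbert space with unit sphere $\mathcal{S}$, $U\subset\mathbf{R}$, and $A,B$ two possibly unbounded operators on $\mathscr{H}$ with domains $D(A),D(B)$. The triple $(A,B,U)$ stands for the formal controlled equation $\frac{d\psi}{dt}(t)=A\psi(t)+u(t)B\psi(t)$, $u(t)\in U$. It is called a skew-adjoint discrete-spectrum control system if: (1) $A$ and $B$ are skew-adjoint; (2) there exists an orthonormal basis $(\phi_n)_{n\in\mathbf{N}}$ of $\mathscr{H}$ made of eigenvectors of $A$; (3) $\phi_n\in D(B)$ for every $n\in\mathbf{N}$. Such a basis is fixed. Meaning of $A+uB$: let $V=\mathrm{span}\{\phi_n\mid n\in\mathbf{N}\}$ (finite linear combinations). For $u\in U$, the operator $A|_V+uB|_V:V\to\mathscr{H}$ is skew-Hermitian and (standing convention) it admits a unique skew-adjoint extension; $A+uB$ denotes this extension. It generates a group of unitary transformations $e^{t(A+uB)}$,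 $t\in\mathbf{R}$. $(A,B,U)$ is approximately controllable if for every $\psi_0,\psi_1\in\mathcal{S}$ and every $\varepsilon>0$ there exist $k\in\mathbf{N}$, $t_1,\dots,t_k>0$ and $u_1,\dots,u_k\in U$ such that $\|\psi_1-e^{t_k(A+u_kB)}\circ\cdots\circ e^{t_1(A+u_1B)}(\psi_0)\|<\varepsilon$. Real numbers $(x_n)_{n\in\mathbf{N}}$ are $\mathbf{Q}$-linearly independent if for every $N\in\mathbf{N}$ and $(q_1,\dots,q_N)\in\mathbf{Q}^N\setminus\{0\}$ one has $\sum_{n=1}^N q_nx_n\neq 0$. *)

(* Defs.v *)
From HB Require Import structures.
From mathcomp Require Import all_boot all_order all_algebra.
From mathcomp Require Import sesquilinear complex.
From mathcomp Require Import all_classical all_reals all_analysis.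

Set Implicit Arguments.
Unset Strict Implicit.
Unset Printing Implicit Defensive.

Import Order.TTheory GRing.Theory Num.Theory.
Import numFieldNormedType.Exports.

Local Open Scope classical_set_scope.
Local Open Scope ring_scope.
Local Open Scope complex_scope.

(* A complex Hilbert space is a complete normed space H over R[i] together with
   a dot product ip such that [hilbert_norm ip] holds.  The dot product is
   linear in its first argument and conjugate-linear in the second one. *)
Definition hilbert_norm (R : realType) (H : completeNormedModType R[i])
    (ip : {dot H for Num.conj}) : Prop :=
  forall x : H, `|x| ^+ 2 = ip x x.

(* A possibly unbounded linear operator.  The underlying function is total and
   is required to vanish outside the domain, so that Leibniz equality is
   equality of operators (see operator_ext). *)
Record operator (R : realType) (H : completeNormedModType R[i]) := Operator {
  domain : set H;
  op_fun :> H -> H;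
  domain0 : domain 0;
  op_linear : forall (a : R[i]) (x y : H), domain x -> domain y ->
    domain (a *: x + y) /\ op_fun (a *: x + y) = a *: op_fun x + op_fun y;
  op_out : forall x : H, ~ domain x -> op_fun x = 0 }.

HB.instance Definition _ (R : realType) (H : completeNormedModType R[i]) :=
  gen_eqMixin (operator H).
HB.instance Definition _ (R : realType) (H : completeNormedModType R[i]) :=
  gen_choiceMixin (operator H).

Lemma operator_ext (R : realType) (H : completeNormedModType R[i])
    (S T : operator H) :
  domain S = domain T -> (forall x, domain S x -> S x = T x) -> S = T.
Proof.
case: S T => [D f D0 fl fo] [D' g D0' gl go] /= eD; subst D' => efg.
have eg : f = g.
  apply/funext => x; case: (pselect (D x)) => [/efg //|nDx].
  by rewrite fo // go.
by subst g; congr Operator; exact: Prop_irrelevance.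
Qed.

Section operators.
Variables (R : realType) (H : completeNormedModType R[i]).
Variable ip : {dot H for Num.conj}.
Implicit Types (C : operator H) (T : R -> H -> H).

(* (y, z) belongs to the graph of the adjoint of C when z = C* y *)
Definition adjoint_graph C : set (H * H) :=
  [set p | forall x, domain C x -> ip (C x) p.1 = ip x p.2].

(* C is densely defined and C* = - C, as an equality of graphs *)
Definition skew_adjoint C : Prop :=
  dense (domain C) /\
  adjoint_graph C = [set p | domain C p.1 /\ p.2 = - C p.1].

Definition unitary (W : H -> H) : Prop :=
  [/\ forall (a : R[i]) x y, W (a *: x + y) = a *: W x + W y,
      forall x y, ip (W x) (W y) = ip x y
    & forall y, exists x, W x = y].

Definition unitary_group T : Prop :=
  [/\ forall t, unitary (T t),
      forall x, T 0 x = x,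
      forall s t x, T (s + t) x = T s (T t x)
    & forall x, continuous (fun t : R => T t x)].

Definition generates C T : Prop :=
  unitary_group T /\
  forall x y : H,
    ((t^-1)%:C *: (T t x - x) @[t --> (0 : R)^'] --> y) <->
    (domain C x /\ y = C x).

(* [expop C t] is e^{tC}: the unitary group generated by C, which exists (by
   Stone's theorem) and is unique when C is skew-adjoint.  The default value,
   irrelevant in that case, is the constant group. *)
Definition expop C : R -> H -> H :=
  @xget (R -> H -> H) (fun _ x => x) [set T | generates C T].

End operators.

Section control.
Variables (R : realType) (H : completeNormedModType R[i]).
Variable ip : {dot H for Num.conj}.
Implicit Types (A B C : operator H) (phi : nat -> H) (U : set R).

Definition finite_span phi : set H :=
  [set v | exists n (c : 'I_n -> R[i]), v = \sum_(k < n) c k *: phi k].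

(* sequences are indexed from 0: phi n stands for the (n+1)-st vector *)
Definition orthonormal_basis phi : Prop :=
  (forall m n, ip (phi m) (phi n) = (m == n)%:R) /\ dense (finite_span phi).

Definition eigenvector A (v : H) : Prop :=
  [/\ v != 0, domain A v & exists mu : R[i], A v = mu *: v].

Definition discrete_spectrum_system A B phi : Prop :=
  [/\ skew_adjoint ip A, skew_adjoint ip B, orthonormal_basis phi,
      forall n, eigenvector A (phi n)
    & forall n, domain B (phi n)].

(* C is a skew-adjoint extension of A|_V + u B|_V, V = finite_span phi *)
Definition skew_adjoint_extension A B phi (u : R) C : Prop :=
  skew_adjoint ip C /\
  forall v, finite_span phi v -> domain C v /\ C v = A v + u%:C *: B v.

Definition unique_extensions A B phi U : Prop :=
  forall u, U u -> exists! C, skew_adjoint_extension A B phi u C.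

(* the operator A + uB; the default value A is irrelevant under
   [unique_extensions] *)
Definition perturbed A B phi (u : R) : operator H :=
  xget A [set C | skew_adjoint_extension A B phi u C].

(* [propagate A B phi [:: (t1, u1); ...; (tk, uk)] psi] is
   e^{tk(A + uk B)} o ... o e^{t1(A + u1 B)} psi *)
Definition propagate A B phi (s : seq (R * R)) (psi : H) : H :=
  foldl (fun x p => expop ip (perturbed A B phi p.2) p.1 x) psi s.

Definition approximately_controllable A B phi U : Prop :=
  forall psi0 psi1 : H, `|psi0| = 1 -> `|psi1| = 1 ->
  forall e : R, 0 < e ->
  exists s : seq (R * R),
    [/\ (0 < size s)%N,
        forall p, p \in s -> 0 < p.1 /\ U p.2
      & `|psi1 - propagate A B phi s psi0| < e%:C].

End control.

Definition Q_linearly_independent (R : realType) (x : nat -> R) : Prop :=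
  forall (N : nat) (q : 'I_N -> rat),
    (exists n, q n != 0) -> \sum_(n < N) ratr (q n) * x n != 0.

(* Main.v *)
(* Call K : V -> H, V the span of the
   eigenvectors, tangent if some reachable operators are 1 + t K + o(t) on V for
   small t > 0.  Tangent directions form a closed convex cone, and a product
   formula shows that a finite-dimensional flow x' = K x is followed by reachable
   operators.  A + u B is tangent for every u, hence so is A (let u -> 0), hence
   so is -A, because e^{tA} is almost periodic; thus B is tangent, and so are all
   its conjugates e^{-sA} B e^{sA}.  By rational independence, averaging these
   against the weight 1 + Re (zeta e^{i s (lambda_{j+1} - lambda_j)}) >= 0 kills
   every matrix element of B except the diagonal and the pair (j, j+1).  The
   diagonal part can be subtracted (again by almost periodicity), which leaves
   the generators of all rotations, with arbitrary phase, of the planes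
   <phi_j, phi_{j+1}>; these act transitively on finite unit vectors.

   That [expop] is not its default value is Stone's theorem: the unitary group
   of C is the limit of the implicit Euler scheme (1 - t C / 2^k)^{-2^k}. *)

Require Import Defs.
From HB Require Import structures.
From mathcomp Require Import all_boot all_order all_algebra.
From mathcomp Require Import sesquilinear complex.
From mathcomp Require Import all_classical all_reals all_analysis.
From mathcomp Require Import ring lra zify.

Set Implicit Arguments.
Unset Strict Implicit.
Unset Printing Implicit Defensive.

Import Order.TTheory GRing.Theory Num.Theory.
Import numFieldNormedType.Exports.

Local Open Scope classical_set_scope.
Local Open Scope ring_scope.
Local Open Scope complex_scope.

(** [B] is unbounded and need not map V into itself, so brackets and exponentials of directions have
    no evident common domain. Tangency is therefore tested on finitely many [phi n] at a time, with
    an error small relative to t, and the operators composed are isometries: two isometries that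
    agree closely on enough [phi n] are close at any prescribed vector, in particular at [K n],
    which may have infinitely many coordinates. The product formula integrates a direction only
    along curves that stay in a finite span, which is why averaging first reduces [B] to single
    planes.

    Controls act for positive times only, so inverses are not given: diagonal flows are reversed by
    Dirichlet's simultaneous approximation, and a rotation is reversed by taking the opposite phase.
    Averages are taken over sampled times [h * m], because finite sums with nonnegative weights stay
    in the cone of directions; h is so small that no nonzero frequency in play is sampled as
    zero. *)

(* Identities in a module are decided by [module_eq] below: both sides are
   reified and compared coefficientwise on their atoms. *)
Section module_identities.
Variables (K : comPzRingType) (V : lmodType K).

Inductive mexpr :=
  | MVar of nat | MZero | MAdd of mexpr & mexpr | MOpp of mexpr
  | MScale of K & mexpr.

Fixpoint meval (env : seq V) (e : mexpr) : V :=
  match e with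
  | MVar n => nth 0 env n
  | MZero => 0
  | MAdd a b => meval env a + meval env b
  | MOpp a => - meval env a
  | MScale k a => k *: meval env a
  end.

(** Indices are compared by [eqn], which [cbn] evaluates on literals; the goals left to [ring] are
    then free of tests. *)
Fixpoint mcoef (e : mexpr) (n : nat) : K :=
  match e with
  | MVar m => if eqn m n then 1 else 0
  | MZero => 0
  | MAdd a b => mcoef a n + mcoef b n
  | MOpp a => - mcoef a n
  | MScale k a => k * mcoef a n
  end.

Fixpoint mcheck (e f : mexpr) (n : nat) : Prop :=
  if n is m.+1 then mcoef e m = mcoef f m /\ mcheck e f m else True.

Lemma meval_coef env e : meval env e = \sum_(i < size env) mcoef e i *: nth 0 env i.
Proof.
elim: e => [n||a IHa b IHb|a IHa|k a IHa] /=; rewrite ?IHa ?IHb.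
- have E m k : eqn m k = (m == k) by [].
  have [nenv|nenv] := ltnP n (size env).
    rewrite (bigD1 (Ordinal nenv)) //= E eqxx scale1r big1 ?addr0 // => i.
    by rewrite -val_eqE /= E eq_sym => /negbTE ->; rewrite scale0r.
  rewrite nth_default // big1 // => i _; rewrite E gtn_eqF ?scale0r //.
  exact: leq_trans (ltn_ord i) nenv.
- by rewrite big1 // => i _; rewrite scale0r.
- by rewrite -big_split /=; apply: eq_bigr => i _; rewrite scalerDl.
- by rewrite -sumrN; apply: eq_bigr => i _; rewrite scaleNr.
- by rewrite scaler_sumr; apply: eq_bigr => i _; rewrite scalerA.
Qed.

Lemma meval_eq env e f : mcheck e f (size env) -> meval env e = meval env f.
Proof.
rewrite !meval_coef => ef; apply: eq_bigr => -[i iN] _ /=; congr (_ *: _).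
elim: (size env) ef i iN => //= n IH [en /IH {}IH] i.
by rewrite ltnS leq_eqVlt => /predU1P[-> //|]; exact: IH.
Qed.

End module_identities.

Ltac atoms_insert e env :=
  lazymatch env with
  | nil => constr:(cons e nil)
  | cons e _ => env
  | cons ?h ?t => let t' := atoms_insert e t in constr:(cons h t')
  end.

Ltac module_atoms e env :=
  lazymatch e with
  | (?a + ?b)%R => let env' := module_atoms a env in module_atoms b env'
  | (- ?a)%R => module_atoms a env
  | (?k *: ?a)%R => module_atoms a env
  | 0%R => env
  | _ => atoms_insert e env
  end.

Ltac atom_index e env :=
  lazymatch env with
  | cons e _ => constr:(O)
  | cons _ ?t => let n := atom_index e t in constr:(S n)
  end.

Ltac module_reify K e env :=
  lazymatch e with
  | (?a + ?b)%R =>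
    let a' := module_reify K a env in let b' := module_reify K b env in
    constr:(@MAdd K a' b')
  | (- ?a)%R => let a' := module_reify K a env in constr:(@MOpp K a')
  | (?k *: ?a)%R => let a' := module_reify K a env in constr:(@MScale K k a')
  | 0%R => constr:(@MZero K)
  | _ => let n := atom_index e env in constr:(@MVar K n)
  end.

Ltac module_eq K V :=
  lazymatch goal with |- @eq ?T ?l ?r =>
    let env0 := module_atoms l (@nil T) in
    let env := module_atoms r env0 in
    let e := module_reify K l env in
    let f := module_reify K r env in
    change (@meval K V env e = @meval K V env f);
    apply: meval_eq; cbn [size mcheck mcoef eqn];
    repeat (split; [try by ring|]); try exact I
  end.

(** * Real-valued norms *)

Section real_norm.
Variables (R : realType).

(** Norms over [R[i]] take values in [R[i]]. Their real part carries all the information ([nmE]) and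
    brings estimates within reach of [lra] and [nra]. *)
Definition nm (V : normedZmodType R[i]) (x : V) : R := complex.Re `|x|.

Section zmod.
Variable (V : normedZmodType R[i]).
Implicit Types x y z : V.

Lemma nmE x : `|x| = (nm x)%:C.
Proof. by rewrite /nm; have := ger0_Im (normr_ge0 x); case: `|x| => a b /= ->. Qed.

Lemma nm_ge0 x : 0 <= nm x.
Proof. by rewrite -lecR -nmE normr_ge0. Qed.

Lemma nm0 : nm (0 : V) = 0.
Proof. by rewrite /nm normr0. Qed.

Lemma nm0_eq0 x : nm x = 0 -> x = 0.
Proof. by move=> x0; apply/eqP; rewrite -normr_eq0 nmE x0. Qed.

Lemma nmD x y : nm (x + y) <= nm x + nm y.
Proof. by rewrite -lecR rmorphD /= -!nmE ler_normD. Qed.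

Lemma nmN x : nm (- x) = nm x.
Proof. by rewrite /nm normrN. Qed.

Lemma nm_distC x y : nm (x - y) = nm (y - x).
Proof. by rewrite /nm distrC. Qed.

Lemma nm_distD z x y : nm (x - y) <= nm (x - z) + nm (z - y).
Proof. by apply: le_trans (nmD _ _); rewrite subrKA. Qed.

Lemma nm_distB x y : nm x - nm y <= nm (x - y).
Proof. by rewrite lerBlDr; apply: le_trans (nmD _ _); rewrite subrK. Qed.

Lemma ler_eps (a b : R) : (forall e : R, 0 < e -> a <= b + e) -> a <= b.
Proof. by move=> ab; apply/ler_addgt0Pr => e; exact: ab. Qed.

Lemma nm_small x : (forall e : R, 0 < e -> nm x <= e) -> x = 0.
Proof.
move=> xe; apply: nm0_eq0; apply/eqP; rewrite eq_le nm_ge0 andbT.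
by apply: ler_eps => e e0; rewrite add0r; exact: xe.
Qed.

Lemma nm_sum (I : Type) (r : seq I) (P : pred I) (F : I -> V) :
  nm (\sum_(i <- r | P i) F i) <= \sum_(i <- r | P i) nm (F i).
Proof.
elim/big_ind2 : _ => [|x a y b xa yb|//]; first by rewrite nm0.
by apply: le_trans (nmD _ _) (lerD xa yb).
Qed.

End zmod.

Lemma nmCE (z : R[i]) : nm z = Num.sqrt (complex.Re z ^+ 2 + complex.Im z ^+ 2).
Proof. by rewrite /nm normc_def. Qed.

Lemma nmC_sqr (z : R[i]) : nm z ^+ 2 = complex.Re z ^+ 2 + complex.Im z ^+ 2.
Proof. by rewrite nmCE sqr_sqrtr // addr_ge0 ?sqr_ge0. Qed.

Lemma nmM (a b : R[i]) : nm (a * b) = nm a * nm b.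
Proof. by apply: complexI; rewrite rmorphM /= -!nmE normrM. Qed.

Lemma nmR (r : R) : nm r%:C = `|r|.
Proof. by rewrite nmCE /= expr0n addr0 sqrtr_sqr. Qed.

Lemma nm1 : nm (1 : R[i]) = 1.
Proof. by rewrite -[1 : R[i]]/((1 : R)%:C) nmR normr1. Qed.

Lemma conjcM (a b : R[i]) : conjc (a * b) = conjc a * conjc b.
Proof. exact: rmorphM. Qed.

Lemma nm_conj (z : R[i]) : nm (conjc z) = nm z.
Proof. by rewrite /nm normcJ. Qed.

Lemma normRe_le_nm (z : R[i]) : `|complex.Re z| <= nm z.
Proof. by rewrite -lecR -nmE normc_ge_Re. Qed.

Lemma nm_le_ReIm (z : R[i]) : nm z <= `|complex.Re z| + `|complex.Im z|.
Proof.
have {1}-> : z = (complex.Re z)%:C + 'i%C * (complex.Im z)%:C by exact: complexE.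
apply: le_trans (nmD _ _) _.
by rewrite nmM !nmR (nmCE 'i%C) /= expr0n add0r expr1n sqrtr1 mul1r.
Qed.

Lemma mulc_conj_nm (z : R[i]) : z * conjc z = (nm z ^+ 2)%:C.
Proof. by rewrite rmorphXn /= -nmE sqr_normc. Qed.

Lemma nmZ (V : normedModType R[i]) (a : R[i]) (x : V) : nm (a *: x) = nm a * nm x.
Proof. by apply: complexI; rewrite rmorphM /= -!nmE normrZ. Qed.

Lemma nmZr (V : normedModType R[i]) (a : R) (x : V) :
  nm (a%:C *: x) = `|a| * nm x.
Proof. by rewrite nmZ nmR. Qed.

Lemma pos_realC (e : R[i]) : 0 < e -> exists2 r : R, 0 < r & e = r%:C.
Proof.
case: e => a b; rewrite ltcE /= => /andP[/eqP -> a0]; by exists a.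
Qed.

Lemma cauchy_ex_lim (V : completeNormedModType R[i]) (u : nat -> V) :
  (forall e : R, 0 < e -> exists N, forall m n, (N <= m)%N -> (N <= n)%N ->
     nm (u m - u n) <= e) ->
  exists l, forall e : R, 0 < e -> exists N, forall n, (N <= n)%N -> nm (u n - l) <= e.
Proof.
move=> cu.
have /cauchy_cvg ul : cauchy (u @ \oo).
  apply/cauchyP => /= e /pos_realC[r r0 ->].
  have [N uN] := cu (r / 2) (divr_gt0 r0 (ltr0Sn _ 1)).
  exists (u N); exists N => // n /= Nn.
  rewrite -ball_normE /= nmE ltcR; apply: le_lt_trans (uN _ _ _ Nn) _ => //.
  by rewrite gtr_pMr // invf_lt1 // ltr1n.
exists (lim (u @ \oo)) => e e0.
have /cvgrPdist_le /(_ e%:C) : u @ \oo --> lim (u @ \oo) by [].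
rewrite ltcR => /(_ e0) [N _ uN]; exists N => n Nn.
by have := uN n Nn; rewrite /= nmE lecR nm_distC.
Qed.

Lemma cvg_real_nmP (V : normedModType R[i]) (f : R -> V) (F : set_system R)
    (FF : Filter F) (l : V) :
  (f t @[t --> F] --> l) <->
  forall e : R, 0 < e -> \forall t \near F, nm (f t - l) <= e.
Proof.
split=> [/cvgrPdist_le fl e e0|fl].
  have := fl e%:C; rewrite ltcR => /(_ e0); apply: filterS => t.
  by rewrite nmE lecR nm_distC.
apply/cvgrPdist_le => /= _ /pos_realC[e e0 ->].
by apply: filterS (fl _ e0) => t; rewrite nmE lecR nm_distC.
Qed.

Lemma dense_nm (V : normedModType R[i]) (D : set V) : dense D ->
  forall (x : V) (e : R), 0 < e -> exists2 y, D y & nm (x - y) <= e.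
Proof.
move=> dD x e e0.
have [||y [xy Dy]] := dD (ball x e%:C); last first.
- exists y => //; move: xy.
  by rewrite -ball_normE /= nmE ltcR => /ltW.
- by apply: ball_open; rewrite ltcR.
- by exists x; apply: ballxx; rewrite ltcR.
Qed.

End real_norm.

(** * Inner product geometry *)

Section hilbert.
Variables (R : realType) (H : completeNormedModType R[i]).
Variable ip : {dot H for Num.conj}.
Hypothesis ip_norm : hilbert_norm ip.
Implicit Types x y z : H.

Lemma ipDl x y z : ip (x + y) z = ip x z + ip y z.
Proof. exact: linearDl. Qed.

Lemma ipBl x y z : ip (x - y) z = ip x z - ip y z.
Proof. exact: linearBl. Qed.

Lemma ip0l z : ip 0 z = 0.
Proof. exact: linear0l. Qed.

Lemma ipZl a x z : ip (a *: x) z = a * ip x z.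
Proof. exact: linearZl_LR. Qed.

Lemma ipDr x y z : ip z (x + y) = ip z x + ip z y.
Proof. exact: linearDr. Qed.

Lemma ipBr x y z : ip z (x - y) = ip z x - ip z y.
Proof. exact: linearBr. Qed.

Lemma ipNr x z : ip z (- x) = - ip z x.
Proof. exact: linearNr. Qed.

Lemma ipZr a x z : ip z (a *: x) = conjc a * ip z x.
Proof. exact: linearZr_LR. Qed.

Lemma ip_suml (I : Type) (r : seq I) (P : pred I) (F : I -> H) z :
  ip (\sum_(i <- r | P i) F i) z = \sum_(i <- r | P i) ip (F i) z.
Proof. exact: linear_sumlz. Qed.

Lemma ipC x y : ip x y = conjc (ip y x).
Proof. by have := hermC ip x y; rewrite expr0 mul1r. Qed.

Lemma ipxx x : ip x x = (nm x ^+ 2)%:C.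
Proof. by rewrite rmorphXn /= -nmE ip_norm. Qed.

Lemma nm_sqr x : nm x ^+ 2 = complex.Re (ip x x).
Proof. by rewrite ipxx. Qed.

Lemma nm_sqrD x y :
  nm (x + y) ^+ 2 = nm x ^+ 2 + nm y ^+ 2 + 2 * complex.Re (ip x y).
Proof.
rewrite !nm_sqr ipDl !ipDr (ipC y x); case: (ip x x) (ip x y) (ip y y) => a b [c d] [e f] /=.
ring.
Qed.

Lemma nm_sqrB x y :
  nm (x - y) ^+ 2 = nm x ^+ 2 + nm y ^+ 2 - 2 * complex.Re (ip x y).
Proof.
by rewrite nm_sqrD nmN ipNr; case: (ip x y) => c d /=; ring.
Qed.

Lemma cauchy_schwarz x y : nm (ip x y) <= nm x * nm y.
Proof.
have [y0|yn0] := eqVneq (nm y) 0.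
  by rewrite (nm0_eq0 y0) nm0 mulr0 ipC ip0l conjc0 nm0.
have y_gt0 : 0 < nm y by rewrite lt_neqAle eq_sym yn0 nm_ge0.
rewrite -ler_sqr ?nnegrE ?mulr_ge0 ?nm_ge0 // exprMn.
(* Up to the factor |y|^2, this vector is the component of x orthogonal to y; the denominator is
   cleared to keep the expansion polynomial. *)
have := sqr_ge0 (nm ((nm y ^+ 2)%:C *: x - ip x y *: y)).
rewrite nm_sqrB nmZr nmZ ipZl ipZr.
have -> : (nm y ^+ 2)%:C * (conjc (ip x y) * ip x y) = (nm y ^+ 2 * nm (ip x y) ^+ 2)%:C.
  by rewrite (mulrC (conjc _)) mulc_conj_nm -rmorphM.
rewrite /= ger0_norm ?sqr_ge0 //.
have y2 : 0 < nm y ^+ 2 by rewrite exprn_gt0.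
rewrite -(ler_pM2l y2).
nra.
Qed.

(** * Fourier sums in the basis *)

Section basis.
Variable phi : nat -> H.
Hypothesis phi_basis : orthonormal_basis ip phi.

Lemma ip_phi m n : ip (phi m) (phi n) = (m == n)%:R.
Proof. by case: phi_basis. Qed.

Lemma nm_phi n : nm (phi n) = 1.
Proof.
apply/eqP; rewrite -sqrp_eq1 ?nm_ge0 // nm_sqr ip_phi eqxx.
by apply/eqP.
Qed.

Lemma ip_sum_phi (c : nat -> R[i]) N k :
  ip (\sum_(i < N) c i *: phi i) (phi k) = if (k < N)%N then c k else 0.
Proof.
rewrite ip_suml; under eq_bigr do rewrite ipZl ip_phi.
case: ifP => [kN|/negbT]; last first.
  rewrite -leqNgt => Nk; apply: big1 => i _.
  by rewrite (ltn_eqF (leq_trans (ltn_ord i) Nk)) mulr0.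
rewrite (bigD1 (Ordinal kN)) //= eqxx mulr1 big1 ?addr0 // => i /negbTE iN.
by rewrite (_ : (i == k :> nat) = false) ?mulr0.
Qed.

Lemma nm_sum_phi (c : nat -> R[i]) N :
  nm (\sum_(i < N) c i *: phi i) ^+ 2 = \sum_(i < N) nm (c i) ^+ 2.
Proof.
elim: N => [|N IH]; first by rewrite !big_ord0 nm0 expr0n.
rewrite !big_ord_recr /= nm_sqrD IH ipZr ip_sum_phi ltnn mulr0 mulr0 addr0.
by rewrite nmZ nm_phi mulr1.
Qed.

Definition fourier_sum N x : H := \sum_(i < N) ip x (phi i) *: phi i.

Lemma fourier_sumB N x y : fourier_sum N (x - y) = fourier_sum N x - fourier_sum N y.
Proof.
rewrite /fourier_sum -sumrB; apply: eq_bigr => i _.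
by rewrite ipBl scalerBl.
Qed.

Lemma fourier_sum_id (c : nat -> R[i]) M N : (M <= N)%N ->
  fourier_sum N (\sum_(i < M) c i *: phi i) = \sum_(i < M) c i *: phi i.
Proof.
move=> MN; rewrite /fourier_sum [RHS](big_ord_widen N (fun i => c i *: phi i)) //.
rewrite [RHS]big_mkcond /=; apply: eq_bigr => i _; rewrite ip_sum_phi.
by case: ifP; rewrite // scale0r.
Qed.

Lemma nm_sub_fourier_sum N x : nm (x - fourier_sum N x) ^+ 2 = nm x ^+ 2 - nm (fourier_sum N x) ^+ 2.
Proof.
rewrite nm_sqrB.
have -> : ip x (fourier_sum N x) = (nm (fourier_sum N x) ^+ 2)%:C.
  rewrite /fourier_sum (nm_sum_phi (fun i => ip x (phi i))) linear_sumr rmorph_sum /=.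
  apply: eq_bigr => i _.
  by rewrite /= ipZr mulrC mulc_conj_nm.
by move=> /=; ring.
Qed.

Lemma nm_sub_fourier_sum_le N x : nm (x - fourier_sum N x) <= nm x.
Proof.
rewrite -ler_sqr ?nnegrE ?nm_ge0 // nm_sub_fourier_sum.
by rewrite gerBl sqr_ge0.
Qed.

(** The remainder x - [fourier_sum M x] is a contraction of x that kills combinations of the first M
    basis vectors. Subtracting from x a finite combination v close to it leaves the remainder
    unchanged and bounds it by |x - v|. *)
Lemma fourier_sum_approx x (e : R) : 0 < e ->
  exists N, forall M, (N <= M)%N -> nm (x - fourier_sum M x) <= e.
Proof.
move=> e0; have [_ /dense_nm/(_ x e e0)[_ [N [c ->]] xe]] := phi_basis.
(* The coefficients indexed by ['I_N] are extended by 0 to all of [nat], the form used by the sum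
   lemmas. *)
exists N => M NM; pose c' i := if insub i is Some j then c j else 0.
have cc' : \sum_(k < N) c k *: phi k = \sum_(k < N) c' k *: phi k.
  by apply: eq_bigr => i _; rewrite /c' valK.
rewrite cc' in xe.
set v := \sum_(k < N) _ in xe.
have -> : x - fourier_sum M x = (x - v) - fourier_sum M (x - v).
  by rewrite fourier_sumB [fourier_sum M v]fourier_sum_id // opprB addrA subrK.
exact: le_trans (nm_sub_fourier_sum_le _ _) xe.
Qed.

Lemma nm_coord_le x k : nm (ip x (phi k)) <= nm x.
Proof. by have := cauchy_schwarz x (phi k); rewrite nm_phi mulr1. Qed.

End basis.
End hilbert.

(** * Orthogonal projection *)

Lemma inv_le_near (R : realType) (a : R) : 0 < a ->
  exists N, forall n, (N <= n)%N -> n.+1%:R^-1 <= a.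
Proof.
move=> a0; exists (Num.trunc a^-1) => n Nn.
rewrite invf_ple ?posrE //; apply: ltW; apply: lt_le_trans (truncnS_gt _) _.
by rewrite ler_nat.
Qed.

Lemma nm_small_mul (R : realType) (V : normedZmodType R[i]) (x : V) (K : R) :
  (forall e : R, 0 < e -> nm x <= e * K) -> x = 0.
Proof.
move=> xK; apply: nm_small => e e0.
have K0 : 0 <= K by have := xK 1 ltr01; rewrite mul1r; apply: le_trans (nm_ge0 _).
have K1 : 0 < K + 1 by rewrite ltr_wpDl.
apply: le_trans (xK (e / (K + 1)) (divr_gt0 e0 K1)) _.
rewrite mulrAC ler_pdivrMr // ler_pM2l //; lra.
Qed.

Section projection_theorem.
Variables (R : realType) (H : completeNormedModType R[i]).
Variable ip : {dot H for Num.conj}.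
Hypothesis ip_norm : hilbert_norm ip.

(** A minimizing sequence for the distance from y to K is Cauchy by the parallelogram identity, as
    midpoints stay in K. Its limit l is in K, and minimality of |y - l| makes y - l orthogonal to
    K. *)
Lemma orthogonal_projection (K : set H) (y : H) :
  K 0 -> (forall (a : R[i]) x z, K x -> K z -> K (a *: x + z)) ->
  (forall x, (forall e : R, 0 < e -> exists2 z, K z & nm (z - x) <= e) -> K x) ->
  exists2 z, K z & forall w, K w -> ip (y - z) w = 0.
Proof.
move=> K0 Klin Kcl.
pose E := [set nm (y - z) | z in K]; pose d := inf E.
have lbE : has_lbound E by exists 0 => _ [z _ <-]; exact: nm_ge0.
have E0 : E !=set0 by exists (nm (y - 0)), 0.
have dK z : K z -> d <= nm (y - z) by move=> Kz; apply: ge_inf => //; exists z.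
have d0 : 0 <= d by apply: lb_le_inf => // _ [z _ <-]; exact: nm_ge0.
have close z1 z2 (a b : R) : 0 <= a -> 0 <= b -> K z1 -> K z2 ->
    nm (y - z1) <= d + a -> nm (y - z2) <= d + b ->
    nm (z1 - z2) ^+ 2 <= 4 * d * (a + b) + 2 * a ^+ 2 + 2 * b ^+ 2.
  move=> a0 b0 K1 K2 z1a z2b.
  have Kmid : K ((2^-1)%:C *: z1 + (2^-1)%:C *: z2).
    by apply: (Klin) => //; rewrite -[_ *: z2]addr0; apply: Klin.
  have := dK _ Kmid; set m := y - _ => dm.
  have e1 : nm ((y - z1) + (y - z2)) = 2 * nm m.
    have -> : (y - z1) + (y - z2) = (2 : R)%:C *: m.
      rewrite /m scalerBr scalerDr !scalerA -!rmorphM /= divff ?pnatr_eq0 // !scale1r.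
      rewrite (_ : (2 : R)%:C = 1 + 1) ?scalerDl ?scale1r; last by rewrite -rmorphD.
      by rewrite opprD addrACA.
    by rewrite nmZr ger0_norm.
  have -> : z1 - z2 = (y - z2) - (y - z1).
    by rewrite opprB [RHS]addrC addrA subrK.
  have := nm_sqrD ip_norm (y - z2) (y - z1); rewrite [_ + (y - z1)]addrC e1.
  rewrite (nm_sqrB ip_norm (y - z2)).
  have n1 := nm_ge0 (y - z1); have n2 := nm_ge0 (y - z2).
  move: (nm (y - z1)) (nm (y - z2)) (nm m) (complex.Re _) dm z1a z2b n1 n2.
  move=> p q r s dm z1a z2b n1 n2 e3.
  have r2 : d ^+ 2 <= r ^+ 2 by rewrite ler_sqr ?nnegrE // (le_trans d0).
  have p2 : p ^+ 2 <= (d + a) ^+ 2 by rewrite ler_sqr ?nnegrE // addr_ge0.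
  have q2 : q ^+ 2 <= (d + b) ^+ 2 by rewrite ler_sqr ?nnegrE // addr_ge0.
  nra.
have small (e : R) : 0 < e -> exists2 a : R, 0 < a &
    forall b c : R, 0 <= b -> b <= a -> 0 <= c -> c <= a -> 
    4 * d * (b + c) + 2 * b ^+ 2 + 2 * c ^+ 2 <= e ^+ 2.
  move=> e0; pose D := 8 * d + 4.
  have D0 : 0 < D by rewrite /D; lra.
  have eD : 0 < e ^+ 2 / D by rewrite divr_gt0 // exprn_gt0.
  exists (Num.min 1 (e ^+ 2 / D)); first by rewrite lt_min ltr01.
  move=> b c b0; rewrite le_min => /andP[b1 bD] c0; rewrite le_min => /andP[c1 cD].
  have : e ^+ 2 = (8 * d + 4) * (e ^+ 2 / D). by rewrite -/D mulrCA divff ?mulr1 // gt_eqF.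
  move: (e ^+ 2 / D) (e ^+ 2) bD cD => r ? bD cD ->.
  nra.
have /choice[z zd] : forall n, exists z, K z /\ nm (y - z) <= d + n.+1%:R^-1.
  move=> n.
   have [|_ [z Kz <-] zd] := @inf_adherent _ E (n.+1%:R^-1) _ (conj E0 lbE).
    by rewrite invr_gt0.
  by exists z; split=> //; apply: ltW.
have [l zl] : exists l, forall e : R, 0 < e -> exists N, forall n, (N <= n)%N -> nm (z n - l) <= e.
  apply: cauchy_ex_lim => e e0; have [a a0 ae] := small e e0.
  have [N Na] := inv_le_near a0; exists N => m n Nm Nn.
  have [Km dm] := zd m; have [Kn dn] := zd n.
  rewrite -ler_sqr ?nnegrE ?nm_ge0 ?(ltW e0) //.
  have := close _ _ _ _ _ _ Km Kn dm dn; rewrite !invr_ge0 !ler0n => /(_ erefl erefl)/le_trans.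
  by apply; apply: ae; rewrite ?invr_ge0 ?ler0n //; apply: Na.
have Kl : K l.
  by apply: Kcl => e /zl[N zN]; exists (z N); [case: (zd N)|exact: zN].
have ld : nm (y - l) <= d.
  apply: ler_eps => e e0; have e2 : 0 < e / 2 by rewrite divr_gt0.
  have [N Ne] := inv_le_near e2; have [M Me] := zl _ e2.
  have [_ zm] := zd (maxn N M).
  have := Ne _ (leq_maxl N M); have := Me _ (leq_maxr N M) => h1 h2.
  have := nm_distD (z (maxn N M)) y l; move: zm h1 h2.
  move: (_^-1) (nm _) (nm _) (nm _) => r p q s; lra.
exists l => // w Kw; set a := ip (y - l) w.
(* Minimality is compared with [l + t a w], where a = <y - l, w>: the first-order term in t is then
   -2 t |a|^2. *)
have key (t : R) : 0 <= t ^+ 2 * nm (a *: w) ^+ 2 - 2 * t * nm a ^+ 2.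
  have Kt : K ((t%:C * a) *: w + l) by exact: Klin.
  have := dK _ Kt; rewrite opprD addrCA addrC => h.
  have := le_trans ld h; rewrite -ler_sqr ?nnegrE ?nm_ge0 //.
  rewrite -scalerA (nm_sqrB ip_norm (y - l)) nmZr.
  have -> : complex.Re (ip (y - l) (t%:C *: (a *: w))) = t * nm a ^+ 2.
    by rewrite ipZr conjc_real ipZr -/a (mulrC _ a) mulc_conj_nm -rmorphM.
  by rewrite exprMn real_normK ?num_real //; lra.
apply: nm0_eq0; apply/eqP; rewrite -sqrf_eq0.
have b0 : 0 <= nm (a *: w) ^+ 2 by exact: sqr_ge0.
have a0 : 0 <= nm a ^+ 2 by exact: sqr_ge0.
move: (nm (a *: w) ^+ 2) (nm a ^+ 2) b0 a0 key => b c b0 c0 key.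
have b1 : 0 < b + 1 by lra.
(* At this t the quadratic is negative unless c = 0; the added 1 keeps the quotient meaningful when
   b = 0. *)
have := key (c / (b + 1)); rewrite exprMn exprVn => h.
rewrite eq_le c0 andbT.
have : 0 <= (c * c) * (b - 2 * (b + 1)).
  have -> : (c * c) * (b - 2 * (b + 1)) =
    (c ^+ 2 / (b + 1) ^+ 2 * b - 2 * (c / (b + 1)) * c) * (b + 1) ^+ 2.
    by field; rewrite gt_eqF.
  by rewrite mulr_ge0 // sqr_ge0.
rewrite nmulr_lge0; last by lra.
move=> cc; nra.
Qed.

End projection_theorem.

(** * Resolvents of skew-adjoint operators *)

Section commuting_contractions.
Variables (R : realType) (V : normedZmodType R[i]).

(** Telescoping: each replacement of one F by one G costs at most |F x - G x|, because the other
    factors commute past it and contract. This estimate drives the convergence of the Euler scheme,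
    its group law and the computation of e^{sA} on eigenvectors. *)
Lemma nm_iter_sub (F G : V -> V) n x :
  (forall y z, F (y - z) = F y - F z) -> (forall y z, G (y - z) = G y - G z) ->
  (forall y, nm (F y) <= nm y) -> (forall y, nm (G y) <= nm y) ->
  (forall y, F (G y) = G (F y)) ->
  nm (iter n F x - iter n G x) <= n%:R * nm (F x - G x).
Proof.
move=> FB GB Fc Gc FG; elim: n => [|n IH]; first by rewrite subrr nm0 mul0r.
apply: le_trans (nm_distD (iter n F (G x)) _ _) _.
rewrite !iterSr -natr1 mulrDl mul1r addrC lerD //.
- rewrite -!iterSr iterS; suff -> : iter n F (G x) = G (iter n F x).
    by rewrite -GB; apply: le_trans (Gc _) IH.
  by elim: n {IH} => //= n ->.
- elim: n {IH} => //= n; rewrite -FB; apply: le_trans; exact: Fc.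
Qed.

End commuting_contractions.

Section stone.
Variables (R : realType) (H : completeNormedModType R[i]).
Variable ip : {dot H for Num.conj}.
Hypothesis ip_norm : hilbert_norm ip.
Variable C : operator H.
Implicit Types x y z w : H.

Local Notation dom := (domain C).

Lemma domP a x y : dom x -> dom y -> dom (a *: x + y).
Proof. by move=> dx dy; case: (op_linear a dx dy). Qed.

Lemma opP a x y : dom x -> dom y -> C (a *: x + y) = a *: C x + C y.
Proof. by move=> dx dy; case: (op_linear a dx dy). Qed.

Lemma op0 : C 0 = 0.
Proof.
have := opP 0 (domain0 C) (domain0 C); rewrite scaler0 addr0 scale0r add0r.
have := opP 1 (domain0 C) (domain0 C); rewrite scaler0 addr0 scale1r.
by move=> /esym/eqP; rewrite -subr_eq0 addrK => /eqP.
Qed.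

Lemma domZ a x : dom x -> dom (a *: x).
Proof. by move=> dx; rewrite -[_ *: _]addr0; apply: domP (domain0 C). Qed.

Lemma opZ a x : dom x -> C (a *: x) = a *: C x.
Proof. by move=> dx; rewrite -[a *: x]addr0 opP ?op0 ?addr0 //; exact: domain0. Qed.

Lemma domB x y : dom x -> dom y -> dom (x - y).
Proof. by move=> dx dy; rewrite addrC -scaleN1r; exact: domP. Qed.

Lemma opB x y : dom x -> dom y -> C (x - y) = C x - C y.
Proof. by move=> dx dy; rewrite addrC -scaleN1r opP // scaleN1r addrC. Qed.

Hypothesis skewC : skew_adjoint ip C.

Lemma skew_ip x y : dom x -> dom y -> ip (C x) y = - ip x (C y).
Proof.
move=> dx dy; case: skewC => _ eqg.
have /(_ x dx) /= : adjoint_graph ip C (y, - C y) by rewrite eqg.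
by rewrite ipNr.
Qed.

Lemma skew_adj x z : (forall w, dom w -> ip (C w) x = ip w z) -> dom x /\ z = - C x.
Proof.
move=> h; case: skewC => _ eqg.
by have : adjoint_graph ip C (x, z) by []; rewrite eqg.
Qed.

Lemma skew_Re x : dom x -> complex.Re (ip x (C x)) = 0.
Proof.
move=> dx; have := skew_ip dx dx; rewrite (ipC _ (C x)).
by case: (ip x (C x)) => a b /(congr1 (@complex.Re R)) /= h; lra.
Qed.

(** The cross term vanishes because <x, C x> is purely imaginary. Hence 1 - hC is injective with
    closed range, and its inverse is a contraction for either sign of h. *)
Lemma nm_resolvent (h : R) x : dom x ->
  nm (x - h%:C *: C x) ^+ 2 = nm x ^+ 2 + h ^+ 2 * nm (C x) ^+ 2.
Proof.
move=> dx; rewrite (nm_sqrB ip_norm x) nmZr ipZr conjc_real exprMn.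
rewrite real_normK ?num_real //.
have := skew_Re dx; case: (ip x (C x)) => a b /= ->; rewrite mulr0 mul0r subr0.
by rewrite mulr0 subr0.
Qed.

(** Adjoints are closed, and - C is the adjoint of C: the adjoint relation passes to the limit by
    Cauchy-Schwarz. *)
Lemma op_closed x z :
  (forall e : R, 0 < e -> exists y, [/\ dom y, nm (y - x) <= e & nm (C y - z) <= e]) ->
  dom x /\ C x = z.
Proof.
move=> h; suff: dom x /\ - z = - C x by case=> dx /oppr_inj.
apply: skew_adj => w dw; apply/eqP; rewrite -subr_eq0; apply/eqP.
apply: (@nm_small_mul _ _ _ (nm (C w) + nm w)) => e e0.
have [y [dy yx yz]] := h e e0.
have -> : ip (C w) x - ip w (- z) = ip w (z - C y) - ip (C w) (y - x).
  by rewrite ipNr opprK !ipBr (skew_ip dw dy); ring.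
apply: le_trans (nmD _ _) _; rewrite nmN addrC mulrDr.
have h1 := cauchy_schwarz ip_norm (C w) (y - x).
have h2 := cauchy_schwarz ip_norm w (z - C y); rewrite (nm_distC z) in h2.
apply: lerD.
- by apply: le_trans h1 _; rewrite mulrC ler_wpM2r ?nm_ge0.
- by apply: le_trans h2 _; rewrite mulrC ler_wpM2r ?nm_ge0.
Qed.

(** The range of 1 - hC is closed, so y can be projected onto it. The defect r is orthogonal to the
    range, which is an adjoint relation: r lies in the domain and r + h C r = 0. The norm identity
    at - h then gives r = 0. *)
Lemma resolvent_surj (h : R) y : h != 0 -> exists2 x, dom x & x - h%:C *: C x = y.
Proof.
move=> h0; have hC0 : h%:C != 0 :> R[i] by rewrite eq_complex /= eqxx andbT.
pose K := [set z | exists2 x, dom x & x - h%:C *: C x = z].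
have [|||z [x dx <-] zK] := @orthogonal_projection _ _ _ ip_norm K y.
- by exists 0; [exact: domain0|rewrite op0 scaler0 subr0].
- move=> a _ _ [x dx <-] [z dz <-]; exists (a *: x + z); first exact: domP.
  rewrite opP // scalerBr scalerDr opprD !scalerA (mulrC a) addrACA.
  by rewrite -!scalerA.
- move=> z zK.
  have /choice[x xz] n : exists x, dom x /\ nm (x - h%:C *: C x - z) <= n.+1%:R^-1.
    by have [|_ [x dx <-] xz] := zK n.+1%:R^-1; [rewrite invr_gt0|exists x].
  have [l lx] : exists l, forall e : R, 0 < e ->
      exists N, forall n, (N <= n)%N -> nm (x n - l) <= e.
    apply: cauchy_ex_lim => e e0; have [N Ne] := inv_le_near (divr_gt0 e0 (ltr0Sn _ 1)).
    exists N => m n Nm Nn; have [dm xm] := xz m; have [dn xn] := xz n.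
    apply: (@le_trans _ _ (nm ((x m - x n) - h%:C *: C (x m - x n)))).
      rewrite -ler_sqr ?nnegrE ?nm_ge0 // nm_resolvent; last exact: domB.
      by rewrite lerDl mulr_ge0 ?sqr_ge0.
    rewrite opB // scalerBr.
    have -> : x m - x n - (h%:C *: C (x m) - h%:C *: C (x n)) =
        (x m - h%:C *: C (x m) - z) - (x n - h%:C *: C (x n) - z).
      by module_eq R[i] H.
    apply: le_trans (nmD _ _) _; rewrite nmN.
    have := Ne _ Nm; have := Ne _ Nn; move: xm xn.
    move: (nm _) (nm _) (_^-1) (_^-1) => p q r s; lra.
  have [dl Cl] : dom l /\ C l = (h^-1)%:C *: (l - z).
    apply: op_closed => e e0.
    have he : 0 < Num.min (e / 2) (e * `|h| / 2).
      by rewrite lt_min !divr_gt0 // mulr_gt0 // normr_gt0.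
    have [N Ne] := inv_le_near he; have [M Me] := lx _ he.
    have NK := Ne _ (leq_maxl N M); have MK := Me _ (leq_maxr N M).
    have [dK xK] := xz (maxn N M); move: NK MK dK xK; move: (maxn N M) => k.
    rewrite !le_min => /andP[_ N2] /andP[M1 M2] dK xK; exists (x k); split=> //.
      by apply: le_trans M1 _; rewrite ler_pdivrMr // ler_pMr // ler1n.
    have -> : C (x k) - (h^-1)%:C *: (l - z) =
        (h^-1)%:C *: ((x k - l) - (x k - h%:C *: C (x k) - z)).
      by module_eq R[i] H; rewrite fmorphV; field.
    rewrite nmZr normfV mulrC ler_pdivrMr ?normr_gt0 //.
    apply: le_trans (nmD _ _) _; rewrite nmN.
    move: N2 M2 xK; move: (nm _) (nm _) (_^-1) => p q r; lra.
  exists l => //.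
  by rewrite Cl scalerA -rmorphM /= divff // scale1r opprB addrC subrK.
- exists x => //; apply/esym/eqP; rewrite -subr_eq0; apply/eqP.
  set r := y - _ in zK *.
  have [dr hr] : dom r /\ (h^-1)%:C *: r = - C r.
    apply: skew_adj => w dw; have /zK : K (w - h%:C *: C w) by exists w.
    rewrite ipBr ipZr conjc_real => /eqP; rewrite subr_eq0 => /eqP rw.
    by rewrite ipZr conjc_real (ipC _ w) rw (ipC _ (C w)) conjcM conjc_real mulrA -rmorphM mulVf ?mul1r.
  have r0 : r - (- h)%:C *: C r = 0.
    by rewrite -[C r]opprK -hr; module_eq R[i] H; rewrite fmorphV rmorphN; field.
  apply: nm0_eq0; have := nm_resolvent (- h) dr; rewrite r0 nm0.
  have := sqr_ge0 (nm r); have : 0 <= (- h) ^+ 2 * nm (C r) ^+ 2 by rewrite mulr_ge0 ?sqr_ge0.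
  move: (_ * _) => a b c d {r0 hr}; apply/eqP; rewrite -sqrf_eq0; apply/eqP.
  rewrite expr0n /= in d; lra.
Qed.
End stone.

(** * The implicit Euler scheme *)

Section exponential.
Variables (R : realType) (H : completeNormedModType R[i]).
Variable ip : {dot H for Num.conj}.
Hypothesis ip_norm : hilbert_norm ip.
Variable C : operator H.
Hypothesis skewC : skew_adjoint ip C.
Implicit Types (x y z w : H) (h s t : R).

Local Notation dom := (domain C).

(* (1 - h C)^-1; for h = 0 the default value of [xget] makes it the identity *)
Definition resolvent h y : H := xget y [set x | dom x /\ x - h%:C *: C x = y].
Local Notation J := resolvent.

Lemma resolvent_uniq h x : dom x -> J h (x - h%:C *: C x) = x.
Proof.
move=> dx; rewrite /J; case: xgetP => [z _ [dz zx]|/(_ x) []] //.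
apply/eqP; rewrite -subr_eq0; apply/eqP; apply: nm0_eq0.
have := nm_resolvent ip_norm skewC h (domB dz dx).
have -> : (z - x) - h%:C *: C (z - x) = 0.
  rewrite opB // -(subrr (x - h%:C *: C x)) -{1}zx; by module_eq R[i] H.
rewrite nm0 expr0n /= => e; apply/eqP; rewrite -sqrf_eq0.
rewrite eq_le sqr_ge0 andbT.
have : 0 <= h ^+ 2 * nm (C (z - x)) ^+ 2 by rewrite mulr_ge0 ?sqr_ge0.
move: (nm _ ^+ 2) (h ^+ 2 * _) e => a b e; lra.
Qed.

Lemma resolvent0 y : J 0 y = y.
Proof.
rewrite /J; case: xgetP => [z _ [_]|//].
by rewrite scale0r subr0.
Qed.

Lemma resolvent_dom h y : h != 0 -> dom (J h y).
Proof.
move=> h0; have [x dx <-] := resolvent_surj ip_norm skewC y h0.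
by rewrite resolvent_uniq.
Qed.

Lemma resolventE h y : J h y - h%:C *: C (J h y) = y.
Proof.
have [->|h0] := eqVneq h 0; first by rewrite resolvent0 scale0r subr0.
have [x dx <-] := resolvent_surj ip_norm skewC y h0.
by rewrite resolvent_uniq.
Qed.

Lemma resolventP h a x y : J h (a *: x + y) = a *: J h x + J h y.
Proof.
have [->|h0] := eqVneq h 0; first by rewrite !resolvent0.
rewrite -{1}(resolventE h x) -{1}(resolventE h y).
have dx := resolvent_dom x h0; have dy := resolvent_dom y h0.
rewrite -[RHS](@resolvent_uniq h); last exact: domP.
by rewrite opP //; congr J; module_eq R[i] H.
Qed.

Lemma resolventB h x y : J h (x - y) = J h x - J h y.
Proof. by rewrite addrC -scaleN1r resolventP scaleN1r addrC. Qed.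

Lemma resolventZ h a x : J h (a *: x) = a *: J h x.
Proof.
have J0 : J h 0 = 0 by rewrite -{1}(subrr x) resolventB subrr.
by rewrite -[a *: x]addr0 resolventP J0 !addr0.
Qed.

Lemma nm_resolvent_le h y : nm (J h y) <= nm y.
Proof.
have [->|h0] := eqVneq h 0; first by rewrite resolvent0.
rewrite -{2}(resolventE h y) -ler_sqr ?nnegrE ?nm_ge0 //.
rewrite (nm_resolvent ip_norm skewC h (resolvent_dom y h0)).
by rewrite lerDl mulr_ge0 ?sqr_ge0.
Qed.

Lemma resolvent_op h x : dom x -> dom (J h x) /\ C (J h x) = J h (C x).
Proof.
move=> dx; have [->|h0] := eqVneq h 0; first by rewrite !resolvent0.
have dJ := resolvent_dom x h0; split=> //.
have hC0 : h%:C != 0 :> R[i] by rewrite eq_complex /= eqxx andbT.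
have CJ : C (J h x) = (h^-1)%:C *: (J h x - x).
  rewrite -{3}(resolventE h x).
  by module_eq R[i] H; rewrite ?fmorphV; field.
have dCJ : dom (C (J h x)) by rewrite CJ; apply/domZ/domB.
rewrite -[LHS](@resolvent_uniq h) //.
by congr (J h _); rewrite -[in RHS](resolventE h x) opB ?opZ //; exact: domZ.
Qed.

Lemma resolventC h s y : J h (J s y) = J s (J h y).
Proof.
have [->|h0] := eqVneq h 0; first by rewrite !resolvent0.
have dv := resolvent_dom y h0.
rewrite -{1}(resolventE h y) resolventB resolventZ.
have [dw <-] := resolvent_op s dv.
by rewrite resolvent_uniq.
Qed.

Lemma resolvent_sub h x : dom x -> J h x - x = h%:C *: J h (C x).
Proof.
move=> dx; have [_ <-] := resolvent_op h dx.
by rewrite -{2}(resolventE h x); module_eq R[i] H.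
Qed.

Lemma nm_resolvent_sub h x : dom x -> nm (J h x - x) <= `|h| * nm (C x).
Proof.
move=> dx; rewrite resolvent_sub // nmZr ler_wpM2l //; exact: nm_resolvent_le.
Qed.

(** Resolvent form of (1 - sC)(1 - tC) = (1 - (s + t)C) + s t C^2: the two sides invert operators
    that agree to first order. *)
Lemma resolvent_add_sub s t x : dom x -> dom (C x) ->
  nm (J (s + t) x - J s (J t x)) <= `|s * t| * nm (C (C x)).
Proof.
move=> dx dCx.
have -> : J (s + t) x - J s (J t x) = (s * t)%:C *: J s (J t (J (s + t) (C (C x)))).
  have e1 : x - t%:C *: C x - s%:C *: C (x - t%:C *: C x) =
      x - (s + t)%:C *: C x + (s * t)%:C *: C (C x).
    rewrite opB ?opZ //; last exact: domZ.
    by rewrite rmorphD rmorphM /=; module_eq R[i] H.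
  have d1 : dom (x - t%:C *: C x) by apply: domB => //; exact: domZ.
  have -> : (s * t)%:C *: J s (J t (J (s + t) (C (C x)))) =
      J s (J t (J (s + t) (x - t%:C *: C x - s%:C *: C (x - t%:C *: C x)))) -
      J s (J t (J (s + t) (x - (s + t)%:C *: C x))).
    rewrite -!resolventB -!resolventZ e1; congr (J s (J t (J (s + t) _))).
    by module_eq R[i] H.
  rewrite (resolvent_uniq _ dx) (resolventC t (s + t)) (resolventC s (s + t)).
  by rewrite (resolventC s t (_ - _)) (resolvent_uniq _ d1) (resolvent_uniq _ dx).
rewrite nmZr ler_wpM2l //.
by apply: le_trans (nm_resolvent_le _ _) _; apply: le_trans (nm_resolvent_le _ _) (nm_resolvent_le _ _).
Qed.
Lemma iter_resolventP n h a x y :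
  iter n (J h) (a *: x + y) = a *: iter n (J h) x + iter n (J h) y.
Proof. by elim: n => //= n ->; rewrite resolventP. Qed.

Lemma nm_iter_resolvent n h x : nm (iter n (J h) x) <= nm x.
Proof. by elim: n => //= n; apply: le_trans; exact: nm_resolvent_le. Qed.

(** With 2^k steps, refinement replaces each factor [J (2 h)] by [J h \o J h], so [nm_iter_sub]
    compares consecutive approximations. *)
Definition euler k t x : H := iter (2 ^ k) (J (t / (2 ^ k)%:R)) x.

Lemma eulerP k t a x y : euler k t (a *: x + y) = a *: euler k t x + euler k t y.
Proof. exact: iter_resolventP. Qed.

Lemma eulerB k t x y : euler k t (x - y) = euler k t x - euler k t y.
Proof. by rewrite addrC -scaleN1r eulerP scaleN1r addrC. Qed.

Lemma nm_euler k t x : nm (euler k t x) <= nm x.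
Proof. exact: nm_iter_resolvent. Qed.

Lemma euler_half k t x : euler k.+1 t x =
  iter (2 ^ k) (J (t / (2 ^ k.+1)%:R) \o J (t / (2 ^ k.+1)%:R)) x.
Proof.
rewrite /euler; set h := t / (2 ^ k.+1)%:R; rewrite expnS mul2n.
by elim: (2 ^ k)%N => // n; rewrite doubleS /= => ->.
Qed.

Lemma euler_comp k s t x : euler k s (euler k t x) =
  iter (2 ^ k) (J (s / (2 ^ k)%:R) \o J (t / (2 ^ k)%:R)) x.
Proof.
rewrite /euler; move: (s / _) (t / _) => a b.
elim: (2 ^ k)%N => //= n <-; congr (J _ _); move: (iter n (J b) x) => y.
by elim: n => //= n ->; rewrite resolventC.
Qed.

Lemma nm_euler_add k s t x : dom x -> dom (C x) ->
  nm (euler k (s + t) x - euler k s (euler k t x)) <=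
  `|s * t| * nm (C (C x)) / (2 ^ k)%:R.
Proof.
move=> dx dCx; have n0 : 0 < (2 ^ k)%:R :> R by rewrite ltr0n expn_gt0.
rewrite euler_comp; apply: le_trans (nm_iter_sub _ _ _ _ _ _ _) _ => /=.
- exact: resolventB.
- by move=> y z; rewrite !resolventB.
- exact: nm_resolvent_le.
- by move=> y; apply: le_trans (nm_resolvent_le _ _) (nm_resolvent_le _ _).
- by move=> y; rewrite resolventC (resolventC _ (t / _)).
rewrite mulrDl; have := resolvent_add_sub (s / (2 ^ k)%:R) (t / (2 ^ k)%:R) dx dCx.
move/(ler_wpM2l (ltW n0))/le_trans; apply.
rewrite mulrACA normrM -invfM normfV (ger0_norm (mulr_ge0 (ltW n0) (ltW n0))).
rewrite le_eqVlt; apply/orP; left; apply/eqP.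
by move: `|_| (nm _) n0 => a M n0; field; rewrite gt_eqF.
Qed.

Lemma nm_euler_step k t x : dom x -> dom (C x) ->
  nm (euler k.+1 t x - euler k t x) <= t ^+ 2 * nm (C (C x)) / (2 ^ k.+1)%:R.
Proof.
move=> dx dCx; have n0 : 0 < (2 ^ k)%:R :> R by rewrite ltr0n expn_gt0.
rewrite nm_distC euler_half; apply: le_trans (nm_iter_sub _ _ _ _ _ _ _) _ => /=.
- exact: resolventB.
- by move=> y z; rewrite !resolventB.
- exact: nm_resolvent_le.
- by move=> y; apply: le_trans (nm_resolvent_le _ _) (nm_resolvent_le _ _).
- by move=> y; rewrite resolventC (resolventC _ (t / (2 ^ k.+1)%:R)).
set h := t / (2 ^ k.+1)%:R.
have -> : t / (2 ^ k)%:R = h + h.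
  by rewrite /h expnS natrM; field; rewrite gt_eqF.
have := resolvent_add_sub h h dx dCx.
move/(ler_wpM2l (ltW n0))/le_trans; apply.
rewrite -expr2 ger0_norm ?sqr_ge0 // /h expnS natrM.
set M := nm _; have M0 : 0 <= M by exact: nm_ge0.
have -> : (2 ^ k)%:R * ((t / (2%:R * (2 ^ k)%:R)) ^+ 2 * M) =
   2^-1 * (t ^+ 2 * M / (2%:R * (2 ^ k)%:R)) by field; rewrite gt_eqF.
rewrite ler_piMl //; last by rewrite invf_le1 ?ler1n.
by rewrite divr_ge0 // mulr_ge0 ?sqr_ge0 // ltW.
Qed.

Lemma nm_euler_diff k d t x : dom x -> dom (C x) ->
  nm (euler (k + d) t x - euler k t x) <= t ^+ 2 * nm (C (C x)) / (2 ^ k)%:R.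
Proof.
move=> dx dCx; set M := t ^+ 2 * _; have M0 : 0 <= M by rewrite mulr_ge0 ?sqr_ge0 ?nm_ge0.
(* The induction on d carries the partial geometric sum M / 2^k - M / 2^(k+d), not just its
   supremum. *)
suff : nm (euler (k + d) t x - euler k t x) <= M / (2 ^ k)%:R - M / (2 ^ (k + d))%:R.
  by move/le_trans; apply; rewrite gerBl divr_ge0.
elim: d => [|d IH]; first by rewrite addn0 !subrr nm0.
apply: le_trans (nm_distD (euler (k + d) t x) _ _) _.
have := nm_euler_step (k + d) t dx dCx; rewrite -/M addnS.
have {}IH : nm (euler (k + d) t x - euler k t x) <=
    M / (2 ^ k)%:R - (M / (2 ^ (k + d).+1)%:R + M / (2 ^ (k + d).+1)%:R).
  by apply: le_trans IH _; rewrite le_eqVlt; apply/orP; left; apply/eqP;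
    rewrite [(2 ^ (k + d).+1)%N]expnS natrM; field; rewrite ?pnatr_eq0 ?expn_eq0.
move: IH; move: (nm _) (nm _) (_ / _) (_ / _) => p q r s; lra.
Qed.

(** For z in the domain, [J h z] tends to z with h, and it lies in the domain of C^2 because C (J h
    z) = J h (C z). *)
Lemma dense_dom2 x (e : R) : 0 < e -> exists y, [/\ dom y, dom (C y) & nm (x - y) <= e].
Proof.
move=> e0; have e2 : 0 < e / 2 by rewrite divr_gt0.
have [/dense_nm/(_ x _ e2)[z dz xz] _] := skewC.
have c0 : 0 < nm (C z) + 1 by rewrite ltr_wpDl ?nm_ge0.
pose h := e / 2 / (nm (C z) + 1); have h0 : 0 < h by rewrite !divr_gt0.
have [dJ CJ] := resolvent_op h dz.
exists (J h z); split=> //; first by rewrite CJ; apply: resolvent_dom; rewrite gt_eqF.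
apply: le_trans (nm_distD z _ _) _; rewrite (nm_distC z).
have := nm_resolvent_sub h dz; rewrite gtr0_norm // => hz.
have : h * nm (C z) <= e / 2.
  by rewrite /h mulrAC ler_pdivrMr // ler_pM2l // lerDl ler01.
move: xz hz; move: (nm _) (nm _) (h * _) => p q r; lra.
Qed.

Lemma pow2_le_near (M e : R) : 0 <= M -> 0 < e ->
  exists N, forall k, (N <= k)%N -> M / (2 ^ k)%:R <= e.
Proof.
move=> M0 e0; have M1 : 0 < M + 1 by lra.
have [N Ne] := inv_le_near (divr_gt0 e0 M1); exists N => k Nk.
have n0 : 0 < (2 ^ k)%:R :> R by rewrite ltr0n expn_gt0.
apply: (@le_trans _ _ ((M + 1) / k.+1%:R)).
  apply: ler_pM; [exact: M0|by rewrite invr_ge0 ltW|lra|].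
  by rewrite lef_pV2 ?posrE ?ltr0Sn // ler_nat ltn_expl.
by have := Ne k Nk; rewrite ler_pdivlMr // mulrC.
Qed.

Lemma euler_cvg t x : exists l, forall e : R, 0 < e ->
  exists N, forall k, (N <= k)%N -> nm (euler k t x - l) <= e.
Proof.
apply: cauchy_ex_lim => e e0.
have e4 : 0 < e / 4 by rewrite divr_gt0.
have [y [dy dCy xy]] := dense_dom2 x e4.
have [N Ne] := @pow2_le_near (t ^+ 2 * nm (C (C y))) (e / 4) (mulr_ge0 (sqr_ge0 _) (nm_ge0 _)) e4.
exists N => m n Nm Nn.
have near_y k : (N <= k)%N -> nm (euler k t x - euler N t y) <= e / 2.
  move=> Nk; apply: le_trans (nm_distD (euler k t y) _ _) _.
  rewrite -eulerB; have := nm_euler k t (x - y).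
  have := nm_euler_diff N (k - N) t dy dCy; rewrite subnKC //.
  move/le_trans => /(_ _ (Ne N (leqnn N))); lra.
apply: le_trans (nm_distD (euler N t y) _ _) _.
rewrite (nm_distC (euler N t y)).
have := near_y _ Nm; have := near_y _ Nn.
move: (nm _) (nm _) => p q; lra.
Qed.

Definition exp_group t x : H :=
  xget 0 [set l | forall e : R, 0 < e ->
    exists N, forall k, (N <= k)%N -> nm (euler k t x - l) <= e].
Local Notation T := exp_group.

Lemma exp_groupE t x (e : R) : 0 < e ->
  exists N, forall k, (N <= k)%N -> nm (euler k t x - T t x) <= e.
Proof.
move: e; rewrite /T; case: xgetP => [l _ //|h].
by have [l lx] := euler_cvg t x; case: (h l).
Qed.

Lemma exp_group_nm t x y (b : R) :
  (forall k, nm (euler k t x - y) <= b) -> nm (T t x - y) <= b.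
Proof.
move=> xy; apply: ler_eps => e e0.
have [N /(_ N (leqnn N)) h] := exp_groupE t x e0.
apply: le_trans (nm_distD (euler N t x) _ _) _.
by rewrite addrC lerD // nm_distC.
Qed.

Lemma exp_groupP t a x y : T t (a *: x + y) = a *: T t x + T t y.
Proof.
apply/eqP; rewrite -subr_eq0; apply/eqP; apply: (@nm_small_mul _ _ _ (1 + nm a + 1)) => e e0.
have [N1 h1] := exp_groupE t (a *: x + y) e0.
have [N2 h2] := exp_groupE t x e0.
have [N3 h3] := exp_groupE t y e0.
pose k := maxn N1 (maxn N2 N3).
have {}h1 : nm (euler k t (a *: x + y) - T t (a *: x + y)) <= e by apply: h1; rewrite leq_maxl.
have {}h2 : nm (euler k t x - T t x) <= e by apply: h2; rewrite leq_max leq_maxl orbT.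
have {}h3 : nm (euler k t y - T t y) <= e by apply: h3; rewrite leq_max leq_maxr orbT.
apply: le_trans (nm_distD (euler k t (a *: x + y)) _ _) _.
rewrite nm_distC !mulrDr mulr1 -addrA; apply: lerD => //.
rewrite eulerP (_ : _ - _ = a *: (euler k t x - T t x) + (euler k t y - T t y)); last first.
  by module_eq R[i] H.
apply: le_trans (nmD _ _) _; apply: lerD => //.
by rewrite nmZ mulrC ler_wpM2r ?nm_ge0.
Qed.

Lemma exp_groupB t x y : T t (x - y) = T t x - T t y.
Proof. by rewrite addrC -scaleN1r exp_groupP scaleN1r addrC. Qed.

Lemma nm_exp_group_le t x : nm (T t x) <= nm x.
Proof.
by rewrite -[T t x]subr0; apply: exp_group_nm => k; rewrite subr0 nm_euler.
Qed.

Lemma exp_group0 x : T 0 x = x.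
Proof.
apply/eqP; rewrite -subr_eq0; apply/eqP; apply: nm0_eq0; apply/eqP.
rewrite eq_le nm_ge0 andbT; apply: exp_group_nm => k.
rewrite /euler mul0r; suff -> : iter (2 ^ k) (J 0) x = x by rewrite subrr nm0.
by elim: (2 ^ k)%N => //= n ->; rewrite resolvent0.
Qed.

(** On the domain of C^2 the group law fails for the Euler scheme only by O(2^-k). Density and
    contractivity extend the limit law to all x, for s and t of either sign. *)
Lemma exp_groupD s t x : T (s + t) x = T s (T t x).
Proof.
apply/eqP; rewrite -subr_eq0; apply/eqP; apply: (@nm_small_mul _ _ _ 6) => e e0.
have [y [dy dCy xy]] := dense_dom2 x e0.
have [N1 h1] := exp_groupE (s + t) y e0.
have [N2 h2] := exp_groupE t y e0.
have [N3 h3] := exp_groupE s (T t y) e0.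
have [N4 h4] := @pow2_le_near (`|s * t| * nm (C (C y))) e (mulr_ge0 (normr_ge0 _) (nm_ge0 _)) e0.
pose k := maxn (maxn N1 N2) (maxn N3 N4).
have {}h1 := h1 k ltac:(by rewrite !leq_max leqnn).
have {}h2 := h2 k ltac:(by rewrite !leq_max leqnn ?orbT).
have {}h3 := h3 k ltac:(by rewrite !leq_max leqnn ?orbT).
have {}h4 := h4 k ltac:(by rewrite !leq_max leqnn ?orbT).
have h5 := nm_euler_add k s t dy dCy.
have h6 : nm (euler k s (euler k t y) - euler k s (T t y)) <= e.
  by rewrite -eulerB; apply: le_trans (nm_euler _ _ _) h2.
have h7 : nm (T s (T t y) - T s (T t x)) <= e.
  rewrite -!exp_groupB; apply: le_trans (nm_exp_group_le _ _) _.
  by apply: le_trans (nm_exp_group_le _ _) _; rewrite nm_distC.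
have h8 : nm (T (s + t) x - T (s + t) y) <= e.
  by rewrite -!exp_groupB; apply: le_trans (nm_exp_group_le _ _) _.
apply: le_trans (nm_distD (T (s + t) y) _ _) _.
have g1 := nm_distD (euler k (s + t) y) (T (s + t) y) (T s (T t x)).
have g2 := nm_distD (euler k s (euler k t y)) (euler k (s + t) y) (T s (T t x)).
have g3 := nm_distD (euler k s (T t y)) (euler k s (euler k t y)) (T s (T t x)).
have g4 := nm_distD (T s (T t y)) (euler k s (T t y)) (T s (T t x)).
rewrite (nm_distC (T (s + t) y) (euler _ _ _)) in g1.
have h9 := le_trans h5 h4.
move: h1 h3 h6 h7 h8 h9 g1 g2 g3 g4; clear.
do 10 move: (nm _); move=> *; lra.
Qed.
End exponential.

(** * Stone's theorem *)

Section isometries.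
Variables (R : realType) (H : completeNormedModType R[i]).
Variable ip : {dot H for Num.conj}.
Hypothesis ip_norm : hilbert_norm ip.

(** Norms determine real parts of products; imaginary parts follow on replacing x by i x. *)
Lemma polarization (W : H -> H) :
  (forall a x y, W (a *: x + y) = a *: W x + W y) ->
  (forall x, nm (W x) = nm x) -> forall x y, ip (W x) (W y) = ip x y.
Proof.
move=> WP Wn x y.
have WD u v : W (u + v) = W u + W v by rewrite -[u]scale1r WP !scale1r.
have Re_eq u v : complex.Re (ip (W u) (W v)) = complex.Re (ip u v).
  have := nm_sqrD ip_norm (W u) (W v); have := nm_sqrD ip_norm u v.
  rewrite -WD !Wn => ->; lra.
have WZ a u : W (a *: u) = a *: W u.
  have W0 : W 0 = 0 by apply: nm0_eq0; rewrite Wn nm0.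
  by rewrite -[a *: u]addr0 WP W0 addr0.
apply/eqP; rewrite eq_complex Re_eq eqxx /=.
have := Re_eq ('i%C *: x) y; rewrite WZ !ipZl.
by case: (ip (W x) (W y)) (ip x y) => a b [c d] /= h; apply/eqP; lra.
Qed.

End isometries.

Section stone_theorem.
Variables (R : realType) (H : completeNormedModType R[i]).
Variable ip : {dot H for Num.conj}.
Hypothesis ip_norm : hilbert_norm ip.
Variable C : operator H.
Hypothesis skewC : skew_adjoint ip C.
Implicit Types (x y z w : H) (h s t : R).

Local Notation dom := (domain C).
Local Notation T := (exp_group C).

Lemma nm_exp_group_sub t x : dom x -> nm (T t x - x) <= `|t| * nm (C x).
Proof.
move=> dx; apply: (exp_group_nm ip_norm skewC) => k; rewrite /euler.
have n0 : 0 < (2 ^ k)%:R :> R by rewrite ltr0n expn_gt0.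
have Eid : iter (2 ^ k) id x = x by elim: (2 ^ k)%N => //= n ->.
have := @nm_iter_sub _ _ (resolvent C (t / (2 ^ k)%:R)) id (2 ^ k) x.
rewrite Eid => /(_ (resolventB ip_norm skewC _) (fun _ _ => erefl)).
move=> /(_ (nm_resolvent_le ip_norm skewC _) (fun _ => lexx _) (fun _ => erefl)).
move/le_trans; apply.
apply: le_trans (ler_wpM2l (ltW n0) (nm_resolvent_sub ip_norm skewC _ dx)) _.
by rewrite mulrA normrM normfV (gtr0_norm n0) mulrCA divff ?mulr1 // gt_eqF.
Qed.

(** At level k = 0 the scheme is the single step [resolvent C t]. One t^2 |C^2 x| bounds the
    distance from that step to later levels, the other its distance from x + t C x. *)
Lemma nm_exp_group_taylor t x : dom x -> dom (C x) ->
  nm (T t x - (x + t%:C *: C x)) <= 2 * t ^+ 2 * nm (C (C x)).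
Proof.
move=> dx dCx; apply: (exp_group_nm ip_norm skewC) => k.
apply: le_trans (nm_distD (resolvent C t x) _ _) _.
have := nm_euler_diff ip_norm skewC 0 k t dx dCx.
rewrite add0n /euler expn0 divr1 divr1 /= => h1.
have -> : resolvent C t x - (x + t%:C *: C x) = t%:C *: (resolvent C t (C x) - C x).
  have -> : resolvent C t x = x + t%:C *: resolvent C t (C x).
    by rewrite -(resolvent_sub ip_norm skewC) // addrC subrK.
  by module_eq R[i] H.
rewrite nmZr.
have := ler_wpM2l (normr_ge0 t) (nm_resolvent_sub ip_norm skewC t dCx).
rewrite mulrA -expr2 real_normK ?num_real // => h2.
move: h1 h2; rewrite /euler; lra.
Qed.

(** The Taylor bound requires the domain of C^2. There x is replaced by y = (1 - hC)^-1 x, for which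
    C y is close to C x; the difference x - y contributes at most |t| |C x - C y|. *)
Lemma exp_group_diff x (e : R) : dom x -> 0 < e -> exists2 d : R, 0 < d &
  forall t, `|t| < d -> nm (T t x - x - t%:C *: C x) <= e * `|t|.
Proof.
move=> dx e0.
(* [C x] may lie outside the domain, so a nearby w in the domain serves to show that the resolvent
   barely moves [C x]. The three errors of e / 8 make up the 3 / 8 below. *)
have [w dw Cw] : exists2 w, dom w & nm (C x - w) <= e / 8.
  have [/dense_nm/(_ (C x) (e / 8)) + _] := skewC.
  by apply; rewrite divr_gt0.
pose h := e / 8 / (nm (C w) + 1); have c1 : 0 < nm (C w) + 1 by rewrite ltr_wpDl ?nm_ge0.
have h0 : 0 < h by rewrite !divr_gt0.
have [dJ CJ] := resolvent_op ip_norm skewC h dx.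
set y := resolvent C h x in dJ CJ.
have dCJ : dom (C y) by rewrite CJ; apply: (resolvent_dom ip_norm skewC); rewrite gt_eqF.
have Cxy : nm (C x - C y) <= e * (3 / 8).
  rewrite CJ nm_distC; apply: le_trans (nm_distD (resolvent C h w) _ _) _.
  rewrite -(resolventB ip_norm skewC).
  apply: le_trans (lerD (nm_resolvent_le ip_norm skewC _ _) (nm_distD w _ _)) _.
  have := nm_resolvent_sub ip_norm skewC h dw; rewrite gtr0_norm // => hw.
  have : h * nm (C w) <= e / 8.
    by rewrite /h mulrAC ler_pdivrMr // ler_pM2l ?divr_gt0 // lerDl ler01.
  by rewrite (nm_distC w); lra.
pose M := 2 * nm (C (C y)); have M0 : 0 <= M by rewrite mulr_ge0 ?nm_ge0.
have M1 : 0 < M + 1 by lra.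
exists (e / 4 / (M + 1)); first by rewrite !divr_gt0.
move=> t td.
have := nm_exp_group_taylor t dJ dCJ.
have := nm_exp_group_sub t (domB dx dJ); rewrite opB // => h1 h2.
have -> : T t x - x - t%:C *: C x = (T t (x - y) - (x - y)) +
    (T t y - (y + t%:C *: C y)) - t%:C *: (C x - C y).
  by rewrite (exp_groupB ip_norm skewC); module_eq R[i] H.
apply: le_trans (nmD _ _) _; rewrite nmN nmZr.
apply: le_trans (lerD (nmD _ _) (lexx _)) _.
have h3 : `|t| * nm (C x - C y) <= `|t| * (e * (3 / 8)) by rewrite ler_wpM2l.
have h4 : 2 * t ^+ 2 * nm (C (C y)) <= `|t| * (e / 4).
  have -> : 2 * t ^+ 2 * nm (C (C y)) = `|t| * (`|t| * M).
    by rewrite mulrA -expr2 real_normK ?num_real // /M; ring.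
  rewrite ler_wpM2l //; move: (ltW td); rewrite ler_pdivlMr //; apply: le_trans.
  by rewrite ler_wpM2l // lerDl ler01.
move: h1 h2 h3 h4; move: (nm _) (nm _) (nm _) => p q r; lra.
Qed.

(** T (- t) is a contraction as well, and it inverts T t. *)
Lemma nm_exp_group t x : nm (T t x) = nm x.
Proof.
apply/eqP; rewrite eq_le (nm_exp_group_le ip_norm skewC) /=.
rewrite -{1}[x](exp_group0 ip_norm skewC) -(addNr t) (exp_groupD ip_norm skewC).
exact: (nm_exp_group_le ip_norm skewC).
Qed.

Lemma exp_group_unitary_group : unitary_group ip T.
Proof.
split.
- move=> t; split.
  + exact: (exp_groupP ip_norm skewC).
  + by apply: polarization => // *; [exact: (exp_groupP ip_norm skewC)|exact: nm_exp_group].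
  + by move=> y; exists (T (- t) y); rewrite -(exp_groupD ip_norm skewC) subrr (exp_group0 ip_norm skewC).
- exact: (exp_group0 ip_norm skewC).
- exact: (exp_groupD ip_norm skewC).
- move=> x t; apply/cvg_real_nmP => e e0.
  have e4 : 0 < e / 4 by rewrite divr_gt0.
  have [/dense_nm/(_ x _ e4)[y dy xy] _] := skewC.
  have c0 : 0 < nm (C y) + 1 by rewrite ltr_wpDl ?nm_ge0.
  near=> s.
  have -> : T s x - T t x = T t (T (s - t) x - x).
    by rewrite (exp_groupB ip_norm skewC) -(exp_groupD ip_norm skewC) [t + _]addrC subrK.
  rewrite nm_exp_group.
  have -> : T (s - t) x - x = T (s - t) (x - y) - (x - y) + (T (s - t) y - y).
    by rewrite (exp_groupB ip_norm skewC); module_eq R[i] H.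
  apply: le_trans (nmD _ _) _; apply: le_trans (lerD (nmD _ _) (nm_exp_group_sub _ dy)) _.
  rewrite nmN nm_exp_group.
  have : `|s - t| * nm (C y) <= e / 4.
    have : `|t - s| <= e / 4 / (nm (C y) + 1).
      near: s; have /cvgrPdist_le tt : (s : R) @[s --> t] --> t by exact: cvg_id.
      by apply: tt; rewrite !divr_gt0.
    rewrite distrC ler_pdivlMr //; apply: le_trans.
    by rewrite ler_wpM2l // lerDl ler01.
  lra.
Unshelve. all: by end_near.
Qed.

Lemma nm_diff_quot s (v w : H) : s != 0 ->
  nm ((s^-1)%:C *: v - w) = nm (v - s%:C *: w) / `|s|.
Proof.
move=> s0; have sC0 : s%:C != 0 :> R[i] by rewrite eq_complex /= eqxx andbT.
have -> : (s^-1)%:C *: v - w = (s^-1)%:C *: (v - s%:C *: w).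
  by module_eq R[i] H; rewrite fmorphV; field.
by rewrite nmZr normfV mulrC.
Qed.

(** If the difference quotients of x converge to y, unitarity moves them onto any w of the domain:
    <C w, x> is the limit of - <w, (T t x - x) / t>, that is - <w, y>. This is the adjoint relation,
    and skew-adjointness places x in the domain. *)
Lemma exp_group_generates : generates ip C T.
Proof.
split=> [|x y]; first exact: exp_group_unitary_group.
have [Tunit _ _ _] := exp_group_unitary_group.
split=> [/cvg_real_nmP xy|[dx ->]]; last first.
  apply/cvg_real_nmP => e e0; have [d d0 dP] := exp_group_diff dx e0.
  near=> t; have t0 : t != 0 by near: t; exact: nbhs_dnbhs_neq.
  rewrite nm_diff_quot // ler_pdivrMr ?normr_gt0 //; apply: dP.
  by near: t; exact: dnbhs0_lt.
suff: dom x /\ - y = - C x by case=> dx /oppr_inj.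
apply: (skew_adj skewC) => w dw; apply/eqP; rewrite -subr_eq0; apply/eqP.
apply: (@nm_small_mul _ _ _ (nm x + nm w)) => e e0.
have [d d0 dP] := exp_group_diff dw e0.
near (0 : R)^' => t.
have t0 : t != 0 by near: t; exact: nbhs_dnbhs_neq.
have xyt : nm ((t^-1)%:C *: (T t x - x) - y) <= e by near: t; exact: xy.
have : nm (((- t)^-1)%:C *: (T (- t) w - w) - C w) <= e.
  rewrite nm_diff_quot ?oppr_eq0 // ler_pdivrMr ?normr_gt0 ?oppr_eq0 //.
  by apply: dP; rewrite normrN; near: t; exact: dnbhs0_lt.
set q := _ *: (T (- t) w - w); set p := _ *: (T t x - x) in xyt * => qw.
have -> : ip (C w) x - ip w (- y) = ip w (y - p) - ip (q - C w) x.
  have -> : ip (q - C w) x = - ip w p - ip (C w) x.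
    rewrite ipBl; congr (_ - _); rewrite /q /p ipZl ipZr conjc_real ipBl ipBr.
    have [_ Tip _] := Tunit t.
    rewrite -(Tip (T (- t) w)) -(exp_groupD ip_norm skewC) subrr (exp_group0 ip_norm skewC).
    by rewrite invrN rmorphN mulNr.
  by rewrite ipBr ipNr; ring.
apply: le_trans (nmD _ _) _; rewrite nmN addrC mulrDr; apply: lerD.
- apply: le_trans (cauchy_schwarz ip_norm _ _) _.
  by rewrite ler_wpM2r ?nm_ge0.
- apply: le_trans (cauchy_schwarz ip_norm _ _) _.
  by rewrite mulrC ler_wpM2r ?nm_ge0 // nm_distC.
Unshelve. all: by end_near.
Qed.

Lemma expop_generates : generates ip C (expop ip C).
Proof. rewrite /expop; case: xgetP => [_ -> //|/(_ T)[]].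
exact: exp_group_generates.
 Qed.

End stone_theorem.

Section generated_group.
Variables (R : realType) (H : completeNormedModType R[i]).
Variable ip : {dot H for Num.conj}.
Hypothesis ip_norm : hilbert_norm ip.

Definition linear_isometry (W : H -> H) : Prop :=
  (forall (a : R[i]) x y, W (a *: x + y) = a *: W x + W y) /\
  forall x, nm (W x) = nm x.

Lemma unitary_isometry (W : H -> H) : unitary ip W -> linear_isometry W.
Proof.
case=> WP Wip _; split=> // x; apply/eqP.
by rewrite -(@eqrXn2 _ 2) ?nm_ge0 // !(nm_sqr ip_norm) Wip.
Qed.

Lemma generates_diff C (T : R -> H -> H) x (e : R) : generates ip C T ->
  domain C x -> 0 < e -> exists2 d : R, 0 < d &
  forall t, `|t| < d -> nm (T t x - (x + t%:C *: C x)) <= e * `|t|.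
Proof.
move=> [[_ T0 _ _] genT] dx e0.
have /cvg_real_nmP/(_ e e0) := (genT x (C x)).2 (conj dx erefl).
move=> /nbhs_ballP[d /= d0 dP]; exists d => // t td.
have [->|t0] := eqVneq t 0.
  by rewrite T0 scale0r addr0 subrr nm0 normr0 mulr0.
have : ball (0 : R) d t by rewrite -ball_normE /= sub0r normrN.
move/dP/(_ t0); rewrite nm_diff_quot // ler_pdivrMr ?normr_gt0 //.
by rewrite opprD addrA.
Qed.

End generated_group.

(** * Tangent directions *)

Section tangent_directions.
Variables (R : realType) (H : completeNormedModType R[i]).
Variable ip : {dot H for Num.conj}.
Hypothesis ip_norm : hilbert_norm ip.
Variable phi : nat -> H.
Hypothesis phi_basis : orthonormal_basis ip phi.
Implicit Types (W : H -> H) (K : nat -> H).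

Lemma isometryB W x y : linear_isometry W -> W (x - y) = W x - W y.
Proof. by case=> WP _; rewrite addrC -scaleN1r WP scaleN1r addrC. Qed.

Lemma isometry0 W : linear_isometry W -> W 0 = 0.
Proof. by move=> Wi; rewrite -{1}(subrr 0) (isometryB _ _ Wi) subrr. Qed.

Lemma isometryZ W a x : linear_isometry W -> W (a *: x) = a *: W x.
Proof.
by move=> Wi; case: (Wi) => WP _; rewrite -[a *: x]addr0 WP (isometry0 Wi) addr0.
Qed.

Lemma isometryD W x y : linear_isometry W -> W (x + y) = W x + W y.
Proof. by case=> WP _; rewrite -[x]scale1r WP !scale1r. Qed.

Lemma isometry_sum W (c : nat -> R[i]) (x : nat -> H) N : linear_isometry W ->
  W (\sum_(k < N) c k *: x k) = \sum_(k < N) c k *: W (x k).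
Proof.
move=> Wi; elim: N => [|N IH]; first by rewrite !big_ord0 (isometry0 Wi).
by rewrite !big_ord_recr /= (isometryD _ _ Wi) (isometryZ _ _ Wi) IH.
Qed.

Lemma isometry_id : linear_isometry (@id H).
Proof. by []. Qed.

Lemma isometry_comp V W : linear_isometry V -> linear_isometry W ->
  linear_isometry (V \o W).
Proof.
move=> [VP Vn] [WP Wn]; split=> [a x y|x] /=; first by rewrite WP VP.
by rewrite Vn Wn.
Qed.

(** Truncating x costs the same under V and W, since both preserve norms; on the truncation only
    finitely many [phi n] matter. Closeness on the basis thus controls the strong operator
    topology. *)
Lemma isometry_close1 (x : H) (e : R) : 0 < e -> exists N (d : R), 0 < d /\
  forall V W, linear_isometry V -> linear_isometry W ->
    (forall n, (n < N)%N -> nm (V (phi n) - W (phi n)) <= d) ->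
    nm (V x - W x) <= e.
Proof.
move=> e0; have e4 : 0 < e / 4 by rewrite divr_gt0.
have [N /(_ N (leqnn N)) xN] := fourier_sum_approx ip_norm phi_basis x e4.
have D0 : 0 < N%:R * nm x + 1 by rewrite ltr_wpDl // mulr_ge0 ?nm_ge0.
exists N, (e / 4 / (N%:R * nm x + 1)); split; first by rewrite divr_gt0.
move=> V W Vi Wi VW; set v := fourier_sum ip phi N x in xN *.
have -> : V x - W x = V (x - v) + (V v - W v) - W (x - v).
  by rewrite (isometryB _ _ Vi) (isometryB _ _ Wi); module_eq R[i] H.
apply: le_trans (nmD _ _) _; apply: le_trans (lerD (nmD _ _) (lexx _)) _.
rewrite nmN Vi.2 Wi.2.
suff : nm (V v - W v) <= e / 4 by lra.
rewrite /v /fourier_sum (isometry_sum (fun k : nat => ip x (phi k)) phi N Vi)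
  (isometry_sum (fun k : nat => ip x (phi k)) phi N Wi) -sumrB.
apply: le_trans (nm_sum _ _ _) _.
apply: (@le_trans _ _ (\sum_(k < N) nm x * (e / 4 / (N%:R * nm x + 1)))).
  apply: ler_sum => k _; rewrite -scalerBr nmZ.
  by apply: ler_pM; rewrite ?nm_ge0 ?(nm_coord_le ip_norm phi_basis) ?VW.
rewrite sumr_const card_ord -[_ *+ _]mulr_natl mulrA mulrCA ler_piMr ?(ltW e4) //.
by rewrite ler_pdivrMr // mul1r lerDl ler01.
Qed.

Lemma isometry_close (x : nat -> H) M (e : R) : 0 < e -> exists N (d : R), 0 < d /\
  forall V W, linear_isometry V -> linear_isometry W ->
    (forall n, (n < N)%N -> nm (V (phi n) - W (phi n)) <= d) ->
    forall m, (m < M)%N -> nm (V (x m) - W (x m)) <= e.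
Proof.
move=> e0; elim: M => [|M [N1 [d1 [d10 h1]]]]; first by exists 0%N, 1.
have [N2 [d2 [d20 h2]]] := isometry_close1 (x M) e0.
exists (maxn N1 N2), (Num.min d1 d2); split; first by rewrite lt_min d10.
move=> V W Vi Wi VW m; rewrite ltnS leq_eqVlt => /predU1P[->|].
  apply: h2 => // n nN; apply: le_trans (VW n _) _; first by rewrite leq_max nN orbT.
  by rewrite ge_min lexx orbT.
apply: h1 => // n nN; apply: le_trans (VW n _) _; first by rewrite leq_max nN.
by rewrite ge_min lexx.
Qed.

Variable S : set (H -> H).
Hypothesis S_id : S id.
Hypothesis S_comp : forall V W, S V -> S W -> S (V \o W).
Hypothesis S_isom : forall W, S W -> linear_isometry W.

(* [tangent K]: the operator with K n = K phi_n is a one-sided derivative at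
   the identity, on finite combinations of the phi_n, of elements of S. *)
Definition tangent K : Prop := forall N (e : R), 0 < e ->
  exists2 t0 : R, 0 < t0 & forall t, 0 < t -> t < t0 ->
  exists2 W, S W & forall n, (n < N)%N ->
    nm (W (phi n) - (phi n + t%:C *: K n)) <= e * t.

(** For [w = U \o phi] with U a linear isometry, this says that U lies in the strong operator
    closure of S. *)
Definition approachable (w : nat -> H) : Prop := forall N (e : R), 0 < e ->
  exists2 W, S W & forall n, (n < N)%N -> nm (W (phi n) - w n) <= e.

Lemma tangent0 : tangent (fun=> 0).
Proof.
move=> N e e0; exists 1 => // t t0 _; exists id => // n _.
by rewrite scaler0 addr0 subrr nm0 mulr_ge0 ?ltW.
Qed.

Lemma tangent_ext K K' : (forall n, K n = K' n) -> tangent K -> tangent K'.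
Proof.
move=> KK' tK N e e0; have [t0 t00 h] := tK N e e0; exists t0 => // t t1 t2.
by have [W SW WK] := h t t1 t2; exists W => // n nN; rewrite -KK'; exact: WK.
Qed.

Lemma tangent_lim K :
  (forall N (e : R), 0 < e -> exists2 K', tangent K' &
     forall n, (n < N)%N -> nm (K n - K' n) <= e) ->
  tangent K.
Proof.
move=> Klim N e e0; have e2 : 0 < e / 2 by rewrite divr_gt0.
have [K' tK' KK'] := Klim N _ e2; have [t0 t00 h] := tK' N _ e2.
exists t0 => // t t1 t2; have [W SW WK] := h t t1 t2; exists W => // n nN.
apply: le_trans (nm_distD (phi n + t%:C *: K' n) _ _) _.
rewrite [e in e * t]splitr mulrDl lerD ?WK //.
rewrite opprD addrACA subrr add0r -scalerBr nmZr gtr0_norm // mulrC.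
by rewrite (ler_wpM2r (ltW t1)) // nm_distC KK'.
Qed.

Lemma tangentZ K (c : R) : 0 < c -> tangent K -> tangent (fun n => c%:C *: K n).
Proof.
move=> c0 tK N e e0; have [t0 t00 h] := tK N (e / c) (divr_gt0 e0 c0).
exists (t0 / c); first by rewrite divr_gt0.
move=> t t1 t2; have [||W SW WK] := h (c * t); first by rewrite mulr_gt0.
  by rewrite mulrC -ltr_pdivlMr.
exists W => // n nN; rewrite scalerA -rmorphM /= mulrC.
by apply: le_trans (WK n nN) _; rewrite mulrA divfK // gt_eqF.
Qed.

Lemma tangent_near_id K : tangent K -> forall N (e : R), 0 < e ->
  exists2 t0 : R, 0 < t0 & forall t, 0 < t -> t < t0 ->
  exists2 W, S W & forall n, (n < N)%N ->
    nm (W (phi n) - (phi n + t%:C *: K n)) <= e * t /\ nm (W (phi n) - phi n) <= e.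
Proof.
move=> tK N e e0; have [t0 t00 h] := tK N e e0.
pose M := \sum_(n < N) nm (K n).
have M0 : 0 <= M by apply: sumr_ge0 => n _; exact: nm_ge0.
have eM : 0 < e + M + 1 by rewrite ltr_wpDl ?addr_ge0 // ltW.
exists (Num.min t0 (e / (e + M + 1))); first by rewrite lt_min t00 divr_gt0.
move=> t t1; rewrite lt_min => /andP[t2 t3].
have [W SW WK] := h t t1 t2; exists W => // n nN; split; first exact: WK.
apply: le_trans (nm_distD (phi n + t%:C *: K n) _ _) _.
rewrite addrAC subrr add0r nmZr gtr0_norm //.
have KM : nm (K n) <= M.
  rewrite /M (bigD1 (Ordinal nN)) //= lerDl; apply: sumr_ge0 => k _; exact: nm_ge0.
move: t3; rewrite ltr_pdivlMr // => t3; have := WK n nN.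
have : t * nm (K n) <= t * M by rewrite (ler_wpM2l (ltW t1)).
move: t3; move: (nm _) (nm _) => p q; nra.
Qed.

(** Composing gives V (phi n + t K' n) = phi n + t K n + t V (K' n) up to o(t). As t decreases, V
    tends to the identity on the basis, hence also at the fixed vector [K' n]. *)
Lemma tangentD K K' : tangent K -> tangent K' -> tangent (fun n => K n + K' n).
Proof.
move=> tK tK' N e e0; have e3 : 0 < e / 3 by rewrite divr_gt0.
have [N1 [d [d0 h]]] := isometry_close K' N e3.
have md : 0 < Num.min d (e / 3) by rewrite lt_min d0.
have [t1 t10 hK] := tangent_near_id tK (maxn N N1) md.
have [t2 t20 hK'] := tK' N _ e3.
exists (Num.min t1 t2); first by rewrite lt_min t10.
move=> t t0; rewrite lt_min => /andP[/(hK t t0)[V SV VK] /(hK' t t0)[W SW WK]].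
have Vi := S_isom SV.
exists (V \o W) => [|n nN /=]; first exact: S_comp.
have VK' : nm (V (K' n) - K' n) <= e / 3.
  apply: (h V id Vi isometry_id _ _ nN) => k kN.
  have [_] := VK k ltac:(by rewrite leq_max kN orbT).
  by rewrite le_min => /andP[].
have [VKn _] := VK n ltac:(by rewrite leq_max nN).
have -> : V (W (phi n)) - (phi n + t%:C *: (K n + K' n)) =
    V (W (phi n) - (phi n + t%:C *: K' n)) + t%:C *: (V (K' n) - K' n) +
    (V (phi n) - (phi n + t%:C *: K n)).
  by rewrite (isometryB _ _ Vi) (isometryD _ _ Vi) (isometryZ _ _ Vi); module_eq R[i] H.
apply: le_trans (nmD _ _) _; apply: le_trans (lerD (nmD _ _) (lexx _)) _.
rewrite Vi.2 nmZr gtr0_norm //; have := WK n nN.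
have : t * nm (V (K' n) - K' n) <= t * (e / 3) by rewrite (ler_wpM2l (ltW t0)).
have : Num.min d (e / 3) * t <= e / 3 * t by rewrite ler_wpM2r ?(ltW t0) // ge_min lexx orbT.
move: VKn; move: (nm _) (nm _) => p q; lra.
Qed.

Lemma tangent_sum (K : nat -> nat -> H) (c : nat -> R) M :
  (forall m, 0 <= c m) -> (forall m, tangent (K m)) ->
  tangent (fun n => \sum_(m < M) (c m)%:C *: K m n).
Proof.
move=> c0 tK; elim: M => [|M IH].
  by apply: tangent_ext tangent0 => n; rewrite big_ord0.
have [cM|cM] := eqVneq (c M) 0.
  by apply: tangent_ext IH => n; rewrite big_ord_recr /= cM scale0r addr0.
have /(tangentD IH) : tangent (fun n => (c M)%:C *: K M n).
  by apply: tangentZ => //; rewrite lt_neqAle eq_sym cM c0.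
by apply: tangent_ext => n; rewrite big_ord_recr.
Qed.

End tangent_directions.

(** * Almost periodicity *)

Section unit_circle.
Variable R : realType.

Definition cis (x : R) : R[i] := cos x +i* sin x.

Lemma cisD x y : cis (x + y) = cis x * cis y.
Proof.
apply/eqP; rewrite /cis eq_complex /= cosD sinD; apply/andP; split; apply/eqP; ring.
Qed.

Lemma cis0 : cis 0 = 1.
Proof. by rewrite /cis cos0 sin0. Qed.

Lemma cisN x : cis (- x) = conjc (cis x).
Proof. by rewrite /cis cosN sinN. Qed.

Lemma nm_cis x : nm (cis x) = 1.
Proof. by rewrite nmCE /= cos2Dsin2 sqrtr1. Qed.

Lemma cisX x n : cis (x * n%:R) = cis x ^+ n.
Proof.
elim: n => [|n IH]; first by rewrite mulr0 cis0.
by rewrite exprS -IH -cisD -natr1 mulrDr mulr1 addrC.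
Qed.

Lemma derive_approx (f : R -> R) (a b : R) (e : R) : is_derive a 1 f b -> 0 < e ->
  exists2 d : R, 0 < d & forall x, `|x| < d -> `|f (a + x) - (f a + x * b)| <= e * `|x|.
Proof.
move=> [fd fE] e0.
have : h^-1 *: (f (h *: (1 : R) + a) - f a) @[h --> (0 : R)^'] --> b.
  by rewrite -fE; exact: fd.
move=> /cvgrPdist_le/(_ e e0)/nbhs_ballP[d /= d0 dP]; exists d => // x xd.
have [->|x0] := eqVneq x 0; first by rewrite mul0r !addr0 subrr normr0 mulr0.
have : ball (0 : R) d x by rewrite -ball_normE /= sub0r normrN.
move=> /dP/(_ x0); rewrite /= -[x *: 1]/(x * 1) mulr1 -[_ *: _]/(x^-1 * _) => h.
rewrite -ler_pdivrMr ?normr_gt0 // -normfV -normrM -normrN.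
by apply: le_trans h; rewrite le_eqVlt; apply/orP; left; apply/eqP; congr (`|_|);
   rewrite (addrC x); field.
Qed.

Lemma cis_approx (e : R) : 0 < e -> exists2 d : R, 0 < d &
  forall x, `|x| < d -> nm (cis x - (1 + x *i)) <= e * `|x|.
Proof.
move=> e0; have e2 : 0 < e / 2 by rewrite divr_gt0.
have [d1 d10 h1] := derive_approx (is_derive_cos 0) e2.
have [d2 d20 h2] := derive_approx (is_derive_sin 0) e2.
exists (Num.min d1 d2); first by rewrite lt_min d10.
move=> x; rewrite lt_min => /andP[/h1 + /h2].
rewrite !add0r cos0 sin0 oppr0 mulr0 addr0 mulr1 => hc hs.
apply: le_trans (nm_le_ReIm _) _ => /=.
by rewrite addr0 add0r in hs * ; lra.
Qed.

Lemma nm_unitX (z : R[i]) n : nm z = 1 -> nm (z ^+ n) = 1.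
Proof. by move=> z1; elim: n => [|n IH]; rewrite ?nm1 // exprS nmM IH z1 mulr1. Qed.

Lemma nm_expr_sub1 (z : R[i]) k : nm z = 1 -> nm (z ^+ k - 1) <= k%:R * nm (z - 1).
Proof.
move=> z1; elim: k => [|k IH]; first by rewrite subrr nm0 mul0r.
have -> : z ^+ k.+1 - 1 = z * (z ^+ k - 1) + (z - 1) by rewrite exprS; ring.
by apply: le_trans (nmD _ _) _; rewrite nmM z1 mul1r -natr1 mulrDl mul1r lerD.
Qed.

(** Pigeonhole on the powers of z. The bound K is uniform in z, which the simultaneous version
    relies on. *)
Lemma dirichlet1 (e : R) : 0 < e -> exists2 K : nat, (0 < K)%N &
  forall z : R[i], nm z = 1 -> exists2 m : nat, (0 < m <= K)%N & nm (z ^+ m - 1) <= e.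
Proof.
move=> e0; pose q := (Num.trunc (2 / e)).+1.
have q0 : 0 < q%:R :> R by [].
have qe : 2 / q%:R <= e.
  by rewrite ler_pdivrMr // mulrC -ler_pdivrMr //; apply/ltW/truncnS_gt.
(* Each coordinate ranges over [-1, 1], cut into cells of width 1 / q; the end point 1 has index 2
   q, whence one extra cell. The Q * Q + 1 powers below cannot all have distinct cells. *)
pose Q := (2 * q).+1; exists (Q * Q)%N => // z z1.
have cell_lt (x : R) : `|x| <= 1 -> (Num.trunc ((x + 1) * q%:R) < Q)%N.
  move=> x1; have x2 : (x + 1) * q%:R <= (2 * q)%:R.
    by rewrite natrM ler_pM2r //; have := ler_norm x; lra.
  by rewrite ltnS -(ler_nat R); apply: le_trans x2; rewrite truncn_le //
     mulr_ge0 // -lerBlDr sub0r; move: x1; rewrite ler_norml => /andP[].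
pose cell (x : R) : 'I_Q := inord (Num.trunc ((x + 1) * q%:R)).
have cell_eq (x y : R) : `|x| <= 1 -> `|y| <= 1 -> cell x = cell y -> `|x - y| <= q%:R^-1.
  move=> x1 y1 /(congr1 val) /=; rewrite !inordK ?cell_lt // => xy.
  have trunc_bounds (w : R) : `|w| <= 1 ->
      (Num.trunc ((w + 1) * q%:R))%:R <= (w + 1) * q%:R
      < (Num.trunc ((w + 1) * q%:R)).+1%:R.
    move=> w1; apply: truncn_itv; rewrite mulr_ge0 // -lerBlDr sub0r.
    by move: w1; rewrite ler_norml => /andP[].
  have := trunc_bounds _ x1; have := trunc_bounds _ y1; rewrite xy.
  move: (Num.trunc _) => n; rewrite -natr1 => /andP[h1 h2] /andP[h3 h4].
  rewrite -(ler_pM2r q0) mulVf ?gt_eqF // -{1}(gtr0_norm q0) -normrM ler_norml.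
  by apply/andP; split; move: h1 h2 h3 h4; move: (n%:R) => r; lra.
pose f (j : 'I_(Q * Q).+1) : 'I_Q * 'I_Q :=
  (cell (complex.Re (z ^+ j)), cell (complex.Im (z ^+ j))).
have /injectivePn[i [j ij fij]] : ~~ injectiveb f.
  apply/negP => /injectiveP/leq_card.
  by rewrite card_prod !card_ord ltnn.
wlog ltij : i j ij fij / (i < j)%N.
  move=> h; have [|ji|/val_inj eij] := ltngtP i j; first exact: h.
    by apply: (h j i) => //; rewrite eq_sym.
  by rewrite eij eqxx in ij.
exists (j - i)%N; first by rewrite subn_gt0 ltij (leq_trans (leq_subr _ _)) // -ltnS.
have zi := nm_unitX i z1; have zj := nm_unitX j z1.
have -> : nm (z ^+ (j - i) - 1) = nm (z ^+ j - z ^+ i).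
  by rewrite -[LHS]mul1r -zi -nmM mulrBr mulr1 -exprD subnKC // ltnW.
have ReIm (w : R[i]) : nm w = 1 -> `|complex.Re w| <= 1 /\ `|complex.Im w| <= 1.
  move=> w1; have := nmC_sqr w; rewrite w1 expr1n => h.
  split; rewrite -(@ler_pXn2r _ 2) ?nnegrE // expr1n real_normK ?num_real // h.
    by rewrite lerDl sqr_ge0.
  by rewrite lerDr sqr_ge0.
case: fij => /esym fRe /esym fIm.
have [ri ii] := ReIm _ zi; have [rj ij'] := ReIm _ zj.
have h1 := cell_eq _ _ rj ri fRe; have h2 := cell_eq _ _ ij' ii fIm.
apply: le_trans qe; apply: le_trans (nm_le_ReIm _) _.
case: (z ^+ i) (z ^+ j) h1 h2 => a b [c d] /= h1 h2.
by move: h1 h2; move: (_^-1) => r; lra.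
Qed.

(** An exponent m good up to e / K for the first N numbers is multiplied by some k <= K that suits z
    N ^+ m; the earlier errors grow at most by the factor K. *)
Lemma dirichlet (z : nat -> R[i]) N (e : R) : (forall n, nm (z n) = 1) -> 0 < e ->
  exists2 m, (0 < m)%N & forall n, (n < N)%N -> nm (z n ^+ m - 1) <= e.
Proof.
move=> z1 e0; elim: N => [|N IH] in e e0 *; first by exists 1%N.
have [K K0 hK] := dirichlet1 e0.
have Kr : 0 < K%:R :> R by rewrite ltr0n.
have [m m0 hm] := IH _ (divr_gt0 e0 Kr).
have [k /andP[k0 kK] hk] := hK (z N ^+ m) (nm_unitX m (z1 N)).
exists (m * k)%N => [|n]; first by rewrite muln_gt0 m0.
rewrite ltnS leq_eqVlt exprM => /predU1P[-> //|nN].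
apply: le_trans (nm_expr_sub1 _ (nm_unitX m (z1 n))) _.
have := hm n nN; rewrite ler_pdivlMr //; apply: le_trans; rewrite mulrC.
by rewrite ler_wpM2l ?nm_ge0 // ler_nat.
Qed.

End unit_circle.

(** * Product formula *)

Section flows.
Variables (R : realType) (H : completeNormedModType R[i]).
Variable ip : {dot H for Num.conj}.
Hypothesis ip_norm : hilbert_norm ip.
Variable phi : nat -> H.
Hypothesis phi_basis : orthonormal_basis ip phi.
Variable S : set (H -> H).
Hypothesis S_id : S id.
Hypothesis S_comp : forall V W, S V -> S W -> S (V \o W).
Hypothesis S_isom : forall W, S W -> linear_isometry W.
Implicit Types (W : H -> H) (K : nat -> H).

Local Notation tangent := (tangent phi S).
Local Notation approachable := (approachable phi S).

Lemma approachable_close U (x : nat -> H) M (e : R) : linear_isometry U ->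
  approachable (U \o phi) -> 0 < e ->
  exists2 W, S W & forall m, (m < M)%N -> nm (W (x m) - U (x m)) <= e.
Proof.
move=> Ui aU e0; have [N [d [d0 h]]] := isometry_close ip_norm phi_basis x M e0.
have [W SW WU] := aU N d d0; exists W => //; apply: h => //; exact: S_isom.
Qed.

Lemma S_iter W n : S W -> S (iter n W).
Proof. by move=> SW; elim: n => [//|n IH]; exact: S_comp SW IH. Qed.

(* Chernoff-type product formula: iterating an element of S tangent to K
   follows any curve in a finite span which solves x' = K x. *)
Lemma tangent_flow K N P (c : nat -> R -> nat -> R[i]) (B : R) :
  tangent K -> 0 <= B -> (forall i t k, (k < N)%N -> nm (c i t k) <= B) ->
  (forall e : R, 0 < e -> exists2 s0 : R, 0 < s0 & forall s, 0 < s -> s < s0 ->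
     forall t i, (i < P)%N ->
     nm (\sum_(k < N) c i (t + s) k *: phi k -
         \sum_(k < N) c i t k *: (phi k + s%:C *: K k)) <= e * s) ->
  forall (t e : R), 0 <= t -> 0 < e ->
  exists2 W, S W & forall i, (i < P)%N ->
    nm (W (\sum_(k < N) c i 0 k *: phi k) - \sum_(k < N) c i t k *: phi k) <= e.
Proof.
move=> tK B0 cB step t e; rewrite le_eqVlt => /predU1P[<- e0|t0 e0].
  by exists id => // i _; rewrite subrr nm0 ltW.
have NB0 : 0 < N%:R * B + 1 by rewrite ltr_wpDl // mulr_ge0.
(* A step of length s costs at most [N * B * e' * s] for the action of W and [e' * s] for the curve;
   over t / s steps this adds up to e. *)
pose e' := e / t / (N%:R * B + 1); have e'0 : 0 < e' by rewrite !divr_gt0.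
have [s1 s10 h1] := tK N e' e'0; have [s2 s20 h2] := step e' e'0.
have smin : 0 < Num.min s1 s2 / 2 / t by rewrite !divr_gt0 // lt_min s10.
have [m /(_ m (leqnn m)) hm] := inv_le_near smin.
pose s := t * m.+1%:R^-1; have s0 : 0 < s by rewrite mulr_gt0 ?invr_gt0.
have ss : s < Num.min s1 s2.
  move: hm; rewrite ler_pdivlMr // mulrC => /le_lt_trans; apply.
  by rewrite gtr_pMr ?lt_min ?s10 // invf_lt1 // ltr1n.
move: ss; rewrite lt_min => /andP[ss1 ss2].
have [W SW WK] := h1 s s0 ss1; have Wi := S_isom SW.
exists (iter m.+1 W) => [|i iP]; first exact: S_iter.
pose v (r : R) := \sum_(k < N) c i r k *: phi k.
have main j : nm (iter j W (v 0) - v (s * j%:R)) <= j%:R * (e * s / t).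
  elim: j => [|j IH]; first by rewrite mulr0 subrr nm0 mul0r.
  pose w := \sum_(k < N) c i (s * j%:R) k *: (phi k + s%:C *: K k).
  have -> : iter j.+1 W (v 0) - v (s * j.+1%:R) =
      W (iter j W (v 0) - v (s * j%:R)) + (W (v (s * j%:R)) - w) - (v (s * j.+1%:R) - w).
    by rewrite (isometryB _ _ Wi) iterS; module_eq R[i] H.
  apply: le_trans (nmD _ _) _; apply: le_trans (lerD (nmD _ _) (lexx _)) _.
  rewrite Wi.2 nmN -natr1 mulrDl mul1r -addrA lerD //.
  have -> : s * (j%:R + 1) = s * j%:R + s by ring.
  have := h2 s s0 ss2 (s * j%:R) i iP; rewrite -/w -/(v _) => h3.
  have h4 : nm (W (v (s * j%:R)) - w) <= N%:R * B * (e' * s).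
    rewrite /v (isometry_sum (c i (s * j%:R)) phi N Wi) /w -sumrB.
    apply: le_trans (nm_sum _ _ _) _.
    apply: (@le_trans _ _ (\sum_(k < N) B * (e' * s))); last first.
      by rewrite sumr_const card_ord -[_ *+ _]mulr_natl mulrA.
    apply: ler_sum => k _; rewrite -scalerBr nmZ.
    by apply: ler_pM; rewrite ?nm_ge0 ?cB ?WK.
  apply: le_trans (lerD h4 h3) _; rewrite -{2}[e' * s]mul1r -mulrDl /e'.
  rewrite le_eqVlt; apply/orP; left; apply/eqP; field.
  by rewrite !gt_eqF.
have st : s * m.+1%:R = t by rewrite /s mulfVK // pnatr_eq0.
have := main m.+1; rewrite st => /le_trans; apply.
have -> : m.+1%:R * (e * s / t) = e * (s * m.+1%:R) / t by ring.
by rewrite st mulfK // gt_eqF.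
Qed.

(** * Reversing diagonal flows *)

Section diagonal.
Variable beta : nat -> R.
Hypothesis tangent_beta : tangent (fun n => (beta n) *i *: phi n).

Lemma approachable_diag_ge0 (t : R) : 0 <= t ->
  approachable (fun n => cis (beta n * t) *: phi n).
Proof.
move=> t0 N e e0.
(* Curve i starts at [phi i] and stays on its complex line; a single W follows all N curves at
   once. *)
pose c (i : nat) (t : R) (k : nat) : R[i] := if i == k then cis (beta i * t) else 0.
have c1 i r k : (k < N)%N -> nm (c i r k) <= 1.
  by rewrite /c; case: eqP; rewrite ?nm_cis ?nm0.
have csum i r (y : nat -> H) : (i < N)%N ->
    \sum_(k < N) c i r k *: y k = cis (beta i * r) *: y i.
  move=> iN; rewrite (bigD1 (Ordinal iN)) //= /c eqxx big1 ?addr0 // => k.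
  by rewrite -val_eqE /= eq_sym => /negbTE ->; rewrite scale0r.
have step (e1 : R) : 0 < e1 -> exists2 s0 : R, 0 < s0 & forall s, 0 < s -> s < s0 ->
     forall r i, (i < N)%N ->
     nm (\sum_(k < N) c i (r + s) k *: phi k -
         \sum_(k < N) c i r k *: (phi k + s%:C *: ((beta k) *i *: phi k))) <= e1 * s.
  move=> e10; pose B := \sum_(k < N) `|beta k| + 1.
  have sB0 : 0 <= \sum_(k < N) `|beta k| by apply: sumr_ge0.
  have B0 : 0 < B by rewrite ltr_wpDl.
  have [d d0 dP] := cis_approx (divr_gt0 e10 B0).
  exists (d / B) => [|s s0 sd r i iN]; first by rewrite divr_gt0.
  have bB : `|beta i| <= B.
    rewrite /B (bigD1 (Ordinal iN)) //= -addrA lerDl addr_ge0 //; exact: sumr_ge0.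
  rewrite (csum i _ phi) // (csum i _ (fun k => phi k + s%:C *: ((beta k) *i *: phi k))) //.
  have -> : cis (beta i * (r + s)) *: phi i -
      cis (beta i * r) *: (phi i + s%:C *: ((beta i) *i *: phi i)) =
      (cis (beta i * r) * (cis (beta i * s) - (1 + (beta i * s) *i))) *: phi i.
    rewrite mulrDr cisD (_ : (beta i * s) *i = s%:C * (beta i) *i); last first.
      by apply/eqP; rewrite eq_complex /=; apply/andP; split; apply/eqP; ring.
    by module_eq R[i] H.
  rewrite nmZ nmM nm_cis mul1r (nm_phi ip_norm phi_basis) mulr1.
  have bs : `|beta i * s| <= B * s by rewrite normrM (gtr0_norm s0) ler_pM2r.
  apply: le_trans (dP _ _) _.
    by apply: le_lt_trans bs _; rewrite mulrC -ltr_pdivlMr.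
  by rewrite mulrAC ler_pdivrMr // -mulrA ler_pM2l // (mulrC s).
have [W SW WP] := tangent_flow tangent_beta ler01 c1 step t0 e0.
exists W => // i iN; have := WP i iN.
by rewrite !csum // mulr0 cis0 scale1r.
Qed.

(** For t < 0, let z be the phases at time - t. If z ^+ m.+1 is close to 1, then z ^+ m is close to
    the inverse of z, so the nonnegative time - t * m imitates time t. *)
Lemma approachable_diag (t : R) : approachable (fun n => cis (beta n * t) *: phi n).
Proof.
have [t0|t0] := lerP 0 t; first exact: approachable_diag_ge0.
move=> N e e0; have e2 : 0 < e / 2 by rewrite divr_gt0.
have [[//|m] _ hm] := dirichlet N (fun n => nm_cis (beta n * - t)) e2.
have s0 : 0 <= - t * m%:R by rewrite mulr_ge0 // oppr_ge0 ltW.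
have [W SW WP] := approachable_diag_ge0 s0 N e2.
exists W => // n nN; apply: le_trans (nm_distD (cis (beta n * (- t * m%:R)) *: phi n) _ _) _.
rewrite [e in _ <= e]splitr lerD ?WP // -scalerBl nmZ (nm_phi ip_norm phi_basis) mulr1.
set z := cis (beta n * - t) in hm *.
have -> : cis (beta n * (- t * m%:R)) - cis (beta n * t) = conjc z * (z ^+ m.+1 - 1).
  have zz : conjc z * z = 1 by rewrite mulrC mulc_conj_nm nm_cis expr1n.
  by rewrite mulrA cisX -/z exprS mulrBr mulrA zz mul1r mulr1 /z -cisN mulrN opprK.
by rewrite nmM nm_conj nm_cis mul1r; exact: hm.
Qed.

(** Time - s is approachable with an error as small as a multiple of s, so the reversed flow has a
    derivative at 0. This serves for the drift and later for the diagonal part of the control. *)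
Lemma tangent_diagN : tangent (fun n => (- beta n) *i *: phi n).
Proof.
move=> N e e0; have e2 : 0 < e / 2 by rewrite divr_gt0.
pose B := \sum_(k < N) `|beta k| + 1.
have B0 : 0 < B by rewrite ltr_wpDl //; apply: sumr_ge0.
have [d d0 dP] := cis_approx (divr_gt0 e2 B0).
exists (d / B) => [|s s0 sd]; first by rewrite divr_gt0.
have es0 : 0 < e / 2 * s by rewrite mulr_gt0.
have [W SW WP] := approachable_diag (- s) N es0; exists W => // n nN.
apply: le_trans (nm_distD (cis (beta n * - s) *: phi n) _ _) _.
rewrite [e in _ <= e * _]splitr mulrDl lerD ?WP //.
have bB : `|beta n| <= B.
  rewrite /B (bigD1 (Ordinal nN)) //= -addrA lerDl addr_ge0 //; exact: sumr_ge0.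
have -> : cis (beta n * - s) *: phi n - (phi n + s%:C *: ((- beta n) *i *: phi n)) =
    (cis (beta n * - s) - (1 + (beta n * - s) *i)) *: phi n.
  rewrite (_ : (beta n * - s) *i = s%:C * (- beta n) *i); last first.
    by apply/eqP; rewrite eq_complex /=; apply/andP; split; apply/eqP; ring.
  by module_eq R[i] H.
rewrite nmZ (nm_phi ip_norm phi_basis) mulr1.
have bs : `|beta n * - s| <= B * s by rewrite normrM normrN (gtr0_norm s0) ler_pM2r.
apply: le_trans (dP _ _) _.
  by apply: le_lt_trans bs _; rewrite mulrC -ltr_pdivlMr.
apply: le_trans (ler_wpM2l (ltW (divr_gt0 e2 B0)) bs) _.
by rewrite mulrA divfK // gt_eqF.
Qed.

End diagonal.
(** Since U^-1 phi n = z n phi n, this is the direction U K U^-1. The approximations D of U^-1 and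
    D' of U may depend on t, so their errors on the basis can be made small relative to t. *)
Lemma tangent_conj K U (z : nat -> R[i]) : linear_isometry U ->
  (forall n, nm (z n) = 1) -> (forall n, z n *: U (phi n) = phi n) ->
  approachable (fun n => z n *: phi n) -> approachable (U \o phi) ->
  tangent K -> tangent (fun n => z n *: U (K n)).
Proof.
move=> Ui z1 zU az aU tK N e e0; have e4 : 0 < e / 4 by rewrite divr_gt0.
have [t0 t00 h] := tK N _ e4; exists t0 => // t tp tt0.
have et : 0 < e / 4 * t by rewrite mulr_gt0.
have [W SW WK] := h t tp tt0; have [D SD Dz] := az N _ et.
(* One list of [phi 0 .. phi (N-1)] followed by [K 0 .. K (N-1)], so that the same D' approximates U
   on both families. *)
pose x n := if (n < N)%N then phi n else K (n - N)%N.
have mt : 0 < Num.min (e / 4 * t) (e / 4) by rewrite lt_min et.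
have [D' SD' DU] := approachable_close x (N + N) Ui aU mt.
have Wi := S_isom SW; have Di := S_isom SD; have D'i := S_isom SD'.
exists (D' \o (W \o D)) => [|n nN /=]; first by apply: S_comp => //; exact: S_comp.
have D'phi : nm (D' (phi n) - U (phi n)) <= e / 4 * t.
  have := DU n ltac:(by rewrite ltn_addr); rewrite /x nN => /le_trans; apply.
  by rewrite ge_min lexx.
have D'K : nm (D' (K n) - U (K n)) <= e / 4.
  have := DU (N + n)%N ltac:(by rewrite ltn_add2l).
  rewrite /x ltnNge leq_addr /= addKn => /le_trans; apply.
  by rewrite ge_min lexx orbT.
have -> : D' (W (D (phi n))) - (phi n + t%:C *: (z n *: U (K n))) =
   D' (W (D (phi n) - z n *: phi n)) + (z n *: D' (W (phi n) - (phi n + t%:C *: K n))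
   + (z n *: (D' (phi n) - U (phi n)) + (t%:C * z n) *: (D' (K n) - U (K n)))).
  rewrite (isometryB _ _ Wi) !(isometryB _ _ D'i) (isometryZ _ _ Wi) (isometryZ _ _ D'i).
  rewrite (isometryD _ _ D'i) (isometryZ _ _ D'i) -{2}[phi n]zU.
  by module_eq R[i] H.
apply: le_trans (nmD _ _) _; apply: le_trans (lerD (lexx _) (nmD _ _)) _.
apply: le_trans (lerD (lexx _) (lerD (lexx _) (nmD _ _))) _.
rewrite !nmZ nmM z1 nmR gtr0_norm // !mul1r mulr1 !D'i.2 Wi.2.
have := WK n nN; have := Dz n nN.
have : t * nm (D' (K n) - U (K n)) <= t * (e / 4) by rewrite ler_pM2l.
lra.
Qed.

End flows.

(** * Averaging *)

Section means.
Variable R : realType.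

Definition mean (x : R) (M : nat) : R[i] :=
  (M%:R^-1)%:C * \sum_(m < M) cis (x * m%:R).

(** For x <> 0 the geometric sum is at most 2 / |cis x - 1|. The bound |x| <= 1 < pi guarantees that
    cis x = 1 only at x = 0. *)
Lemma mean_cvg (x e : R) : `|x| <= 1 -> 0 < e ->
  \forall M \near \oo, nm (mean x M - (x == 0)%:R) <= e.
Proof.
move=> x1 e0; have [x0|x0] := eqVneq x 0.
  exists 1%N => // M /= M0; rewrite /mean x0 (eq_bigr (fun=> 1)) => [|m _]; last first.
    by rewrite mul0r cis0.
  rewrite sumr_const card_ord -(rmorph_nat (real_complex R)) -rmorphM mulVf ?pnatr_eq0 -?lt0n //.
  by rewrite subrr nm0 ltW.
have cx : 0 < nm (cis x - 1).
  rewrite lt_neqAle nm_ge0 andbT eq_sym; apply/eqP => /nm0_eq0/eqP.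
  rewrite subr_eq0 /cis eq_complex /= => /andP[_ /eqP sx].
  have pi1 : 1 < pi :> R by have := pi_ge2 R; lra.
  have [xp|xn|xz] := ltrgt0P x; last by rewrite xz eqxx in x0.
  - have : 0 < sin x by apply: sin_gt0_pi; rewrite xp /=; move: x1; rewrite gtr0_norm //; lra.
    by rewrite sx ltxx.
  - have : 0 < sin (- x).
      by apply: sin_gt0_pi; rewrite oppr_gt0 xn /=; move: x1; rewrite ltr0_norm //; lra.
    by rewrite sinN sx oppr0 ltxx.
have [N Ne] := inv_le_near (divr_gt0 (mulr_gt0 e0 cx) (ltr0Sn R 1)).
exists N.+1 => // -[//|M] /= NM; have {}Ne := Ne M NM.
rewrite subr0 /mean nmM nmR gtr0_norm ?invr_gt0 //.
have geo : (cis x - 1) * \sum_(m < M.+1) cis (x * m%:R) = cis x ^+ M.+1 - 1.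
  by rewrite subrX1; congr (_ * _); apply: eq_bigr => m _; rewrite cisX.
have : nm (cis x - 1) * nm (\sum_(m < M.+1) cis (x * m%:R)) <= 2.
  rewrite -nmM geo; apply: le_trans (nmD _ _) _.
  by rewrite nmN nm1 nm_unitX ?nm_cis.
have i0 : 0 < M.+1%:R^-1 :> R by rewrite invr_gt0.
move: (nm (\sum_(m < M.+1) _)) => s cs; rewrite -(ler_pM2r cx).
have := ler_wpM2l (ltW i0) cs; move: Ne i0; set r : R := M.+1%:R^-1 => h1 h2; lra.
Qed.

Lemma cis_mulr_conj (zeta : R[i]) (x : R) :
  (complex.Re (zeta * cis x))%:C =
  zeta / 2 * cis x + conjc zeta / 2 * cis (- x).
Proof.
by rewrite ReJ_add conjcM cisN; field.
Qed.

End means.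

Section averaging.
Variables (R : realType) (H : completeNormedModType R[i]).
Variable ip : {dot H for Num.conj}.
Hypothesis ip_norm : hilbert_norm ip.
Variable phi : nat -> H.
Hypothesis phi_basis : orthonormal_basis ip phi.
Variable S : set (H -> H).
Hypothesis S_id : S id.
Hypothesis S_comp : forall V W, S V -> S W -> S (V \o W).
Hypothesis S_isom : forall W, S W -> linear_isometry W.
Variables (lambda : nat -> R) (U : R -> H -> H).
Hypothesis U_isom : forall s, linear_isometry (U s).
Hypothesis U_phi : forall s n, U s (phi n) = cis (lambda n * s) *: phi n.
Hypothesis U_approachable : forall s, approachable phi S (U s \o phi).
Variable K : nat -> H.
Hypothesis tangentK : tangent phi S K.
Variable j : nat.
Local Notation omega := (lambda j.+1 - lambda j).
Hypothesis lambda_inj : forall n k, lambda n = lambda k -> n = k.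
Hypothesis lambda_gap : forall n k, lambda n - lambda k = omega -> n = j.+1 /\ k = j.

Local Notation tangent := (tangent phi S).

Let b n k := ip (K n) (phi k).

(* These Riesz weights are nonnegative and have frequencies 0, omega and
   - omega only, so that by [lambda_gap] no other matrix element survives. *)
Let weight (zeta : R[i]) (h : R) m : R := 1 + complex.Re (zeta * cis (omega * h * m%:R)).
(** This is U(-s) K U(s) at [phi n], with s = h m; its coordinate on [phi k] is [b n k] times cis
    ((lambda n - lambda k) s). *)
Let conjK (h : R) m n : H := cis (lambda n * (h * m%:R)) *: U (- (h * m%:R)) (K n).
Let avg zeta h M n : H := \sum_(m < M) (weight zeta h m / M%:R)%:C *: conjK h m n.

Lemma weight_ge0 zeta h m : nm zeta <= 1 -> 0 <= weight zeta h m <= 2.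
Proof.
move=> z1; have := normRe_le_nm (zeta * cis (omega * h * m%:R)).
by rewrite nmM nm_cis mulr1 ler_norml /weight; move: z1; move=> h1 /andP[h2 h3];
  apply/andP; split; lra.
Qed.

Lemma tangent_avg zeta h M : nm zeta <= 1 -> tangent (avg zeta h M).
Proof.
move=> z1; rewrite /avg.
apply: (@tangent_sum _ _ _ ip_norm _ phi_basis S S_id S_comp S_isom
  (conjK h) (fun m => weight zeta h m / M%:R)).
  by move=> m; rewrite divr_ge0 //; case/andP: (weight_ge0 h m z1).
move=> m; apply: (tangent_conj ip_norm phi_basis S_comp S_isom) => //.
- by move=> n; rewrite nm_cis.
- by move=> n; rewrite U_phi scalerA -cisD mulrN subrr cis0 scale1r.
- by move=> N e e0; have [W SW WU] := U_approachable (h * m%:R) N e0; exists W => // n nN;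
    rewrite -U_phi; exact: WU.
Qed.

Lemma avg_coefE zeta (h : R) M (nu : R) :
  \sum_(m < M) (weight zeta h m / M%:R)%:C * cis (nu * h * m%:R) =
  mean (nu * h) M + zeta / 2 * mean ((nu + omega) * h) M
  + conjc zeta / 2 * mean ((nu - omega) * h) M.
Proof.
rewrite /mean !mulr_sumr -!big_split /=; apply: eq_bigr => m _.
have -> : (weight zeta h m / M%:R)%:C = (M%:R^-1)%:C *
    (1 + (complex.Re (zeta * cis (omega * h * m%:R)))%:C).
  by rewrite mulrC rmorphM; congr (_ * _); exact: rmorphD.
rewrite cis_mulr_conj.
have -> : (nu + omega) * h * m%:R = nu * h * m%:R + omega * h * m%:R by ring.
have -> : (nu - omega) * h * m%:R = nu * h * m%:R + - (omega * h * m%:R) by ring.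
rewrite !cisD; ring.
Qed.

(** Limit of the averaged multiplier of [b n k]: frequency 0 survives on the diagonal, - omega at
    (j, j.+1) and omega at (j.+1, j). *)
Let target_coef (zeta : R[i]) n k : R[i] :=
  (n == k)%:R + zeta / 2 * ((n == j) && (k == j.+1))%:R
  + conjc zeta / 2 * ((n == j.+1) && (k == j))%:R.

Lemma freq_eq0 n k : (lambda n - lambda k == 0) = (n == k).
Proof.
by apply/eqP/eqP => [/eqP|->]; rewrite ?subrr // subr_eq0 => /eqP/lambda_inj.
Qed.

Lemma freq_subl n k : (lambda n - lambda k - omega == 0) = (n == j.+1) && (k == j).
Proof.
rewrite subr_eq0; apply/eqP/andP => [/lambda_gap[-> ->] //|[/eqP-> /eqP->]].
by [].
Qed.

Lemma freq_addl n k : (lambda n - lambda k + omega == 0) = (n == j) && (k == j.+1).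
Proof. by rewrite addrC addr_eq0 opprB eq_sym -subr_eq0 freq_subl andbC. Qed.

(** Three means occur, at the frequencies nu, nu + omega and nu - omega with nu = lambda n - lambda
    k. Smallness of h keeps h times each of them in [-1, 1], so sampling creates no spurious
    resonance. *)
Lemma avg_coef_cvg zeta n k (h e : R) : nm zeta <= 1 -> 0 < h ->
  (`|lambda n| + `|lambda k| + `|lambda j.+1| + `|lambda j|) * h <= 1 -> 0 < e ->
  \forall M \near \oo,
    nm (\sum_(m < M) (weight zeta h m / M%:R)%:C * cis ((lambda n - lambda k) * h * m%:R)
        - target_coef zeta n k) <= e.
Proof.
move=> z1 h0 small e0; have e3 : 0 < e / 3 by rewrite divr_gt0.
have abs4 (s1 s2 : bool) : `|((lambda n - lambda k) *+ s1
     + omega *+ s2) * h| <= 1 /\ `|((lambda n - lambda k) *+ s1 - omega *+ s2) * h| <= 1.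
  have lek (r : R) : r <= `|r| /\ - r <= `|r| by split; rewrite ?ler_norm // -normrN ler_norm.
  have [a1 a2] := lek (lambda n); have [b1 b2] := lek (lambda k).
  have [c1 c2] := lek (lambda j.+1); have [d1 d2] := lek (lambda j).
  have bound (r : R) : `|r| <= `|lambda n| + `|lambda k| + `|lambda j.+1| + `|lambda j| ->
      `|r * h| <= 1.
    by move=> rs; rewrite normrM (gtr0_norm h0); apply: le_trans small; rewrite ler_pM2r.
  by split; apply: bound; rewrite ler_norml; apply/andP; split;
    case: s1 s2 => -[]; rewrite ?mulr1n ?mulr0n; lra.
have [i1 _] := abs4 true false; have [i2 i3] := abs4 true true.
rewrite mulr1n mulr0n addr0 in i1; rewrite !mulr1n in i2 i3.
have eq0h (r : R) : (r * h == 0) = (r == 0) by rewrite mulf_eq0 (gt_eqF h0) orbF.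
have f1 := mean_cvg i1 e3; have f2 := mean_cvg i2 e3; have f3 := mean_cvg i3 e3.
apply: filterS3 f1 f2 f3 => M.
rewrite !eq0h freq_eq0 freq_addl freq_subl avg_coefE => h1 h2 h3.
set p := mean _ _ in h1 *; set q := mean _ _ in h2 *; set r := mean _ _ in h3 *.
have -> : p + zeta / 2 * q + conjc zeta / 2 * r - target_coef zeta n k =
  (p - (n == k)%:R) + (zeta / 2 * (q - ((n == j) && (k == j.+1))%:R)
  + conjc zeta / 2 * (r - ((n == j.+1) && (k == j))%:R)).
  by rewrite /target_coef; ring.
have half (z : R[i]) : nm z <= 1 -> nm (z / 2) <= 1.
  move=> z1'; rewrite -[2 : R[i]]/(2%:R) -(rmorph_nat (real_complex R)) -fmorphV nmM nmR.
  by rewrite ger0_norm ?invr_ge0 //; have := nm_ge0 z; lra.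
apply: le_trans (nmD _ _) _; apply: le_trans (lerD (lexx _) (nmD _ _)) _.
rewrite [X in _ <= X](_ : e = e / 3 + (1 * (e / 3) + 1 * (e / 3))); last by field.
apply: lerD => //; rewrite !nmM -[nm zeta * nm _]nmM -[nm (conjc zeta) * nm _]nmM.
by apply: lerD; apply: ler_pM; rewrite ?nm_ge0 ?half ?nm_conj.
Qed.

(** The bound n + j + 3 exceeds n, j and j.+1, the only k whose multiplier can be nonzero. *)
Let target zeta n : H := \sum_(k < n + j + 3) (b n k * target_coef zeta n k) *: phi k.

Lemma target_widen zeta n P : (n + j + 3 <= P)%N ->
  target zeta n = \sum_(k < P) (b n k * target_coef zeta n k) *: phi k.
Proof.
move=> nP; rewrite /target.
rewrite (big_ord_widen P (fun k => (b n k * target_coef zeta n k) *: phi k)) // big_mkcond.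
apply: eq_bigr => k _; case: ifP => // /negbT; rewrite -leqNgt => nk.
have [k1 k2 k3] : [/\ (n == k) = false, (k == j.+1 :> nat) = false & (k == j :> nat) = false].
  by split; apply/eqP; lia.
by rewrite /target_coef k1 k2 k3 !andbF !mulr0 !addr0 mulr0 scale0r.
Qed.

Lemma avgE zeta h M n (x : H) P : x = \sum_(k < P) b n k *: phi k ->
  \sum_(m < M) (weight zeta h m / M%:R)%:C *:
      (cis (lambda n * (h * m%:R)) *: U (- (h * m%:R)) x) =
  \sum_(k < P) (b n k * \sum_(m < M) (weight zeta h m / M%:R)%:C
      * cis ((lambda n - lambda k) * h * m%:R)) *: phi k.
Proof.
move=> ->; under [RHS]eq_bigr do rewrite mulr_sumr scaler_suml.
rewrite exchange_big /=; apply: eq_bigr => m _.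
rewrite (isometry_sum (b n) phi P (U_isom _)) !scaler_sumr; apply: eq_bigr => k _.
rewrite U_phi !scalerA; congr (_ *: _).
have -> : (lambda n - lambda k) * h * m%:R = lambda n * (h * m%:R) + lambda k * - (h * m%:R).
  by ring.
by rewrite cisD; ring.
Qed.

(** The weights lie in [0, 2]. The bound is independent of h and M, so the tail of [K n] can be cut
    off before h and M are chosen. *)
Lemma nm_avg_le zeta h M n (x : H) : nm zeta <= 1 ->
  nm (\sum_(m < M) (weight zeta h m / M%:R)%:C *:
      (cis (lambda n * (h * m%:R)) *: U (- (h * m%:R)) x)) <= 2 * nm x.
Proof.
move=> z1; have [->|M0] := posnP M; first by rewrite big_ord0 nm0 mulr_ge0 ?nm_ge0.
apply: le_trans (nm_sum _ _ _) _.
apply: (@le_trans _ _ (\sum_(m < M) 2 / M%:R * nm x)).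
  apply: ler_sum => m _; rewrite nmZr nmZ nm_cis mul1r (U_isom _).2.
  have /andP[w0 w2] := weight_ge0 h m z1.
  by rewrite ger0_norm ?divr_ge0 // ler_wpM2r ?nm_ge0 // ler_wpM2r ?invr_ge0.
rewrite sumr_const card_ord -[_ *+ M]mulr_natl mulrA mulrCA divff ?mulr1 //.
by rewrite pnatr_eq0 -lt0n.
Qed.

Lemma tangent_target zeta : nm zeta <= 1 -> tangent (target zeta).
Proof.
move=> z1; apply: (@tangent_lim _ _ phi S) => N e e0.
have e8 : 0 < e / 8 by rewrite divr_gt0.
have [P0 hP0] : exists P0, forall P, (P0 <= P)%N -> forall n, (n < N)%N ->
    nm (K n - fourier_sum ip phi P (K n)) <= e / 8.
  elim: N => [|N [P1 h1]]; first by exists 0%N.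
  have [P2 h2] := fourier_sum_approx ip_norm phi_basis (K N) e8.
  exists (maxn P1 P2) => P; rewrite geq_max => /andP[p1 p2] n.
  by rewrite ltnS leq_eqVlt => /predU1P[->|]; [exact: h2|exact: h1].
pose P := maxn P0 (N + j + 3).
pose L := \sum_(i < P + j + 2) `|lambda i|.
have L0 : 0 <= L by apply: sumr_ge0.
have lamL i : (i < P + j + 2)%N -> `|lambda i| <= L.
  by move=> iP; rewrite /L (bigD1 (Ordinal iP)) //= lerDl; apply: sumr_ge0.
have NP : (N + j + 3 <= P)%N by rewrite /P leq_maxr.
(* L bounds each of the four |lambda| entering the smallness condition; the added 1 keeps h positive
   and finite. *)
pose h := (4 * L + 1)^-1; have h0 : 0 < h by rewrite invr_gt0; lra.
pose C := \sum_(n < N) nm (K n) + 1.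
have sC0 : 0 <= \sum_(n < N) nm (K n) by apply: sumr_ge0 => n _; exact: nm_ge0.
have C0 : 0 < C by rewrite ltr_wpDl.
have KC n : (n < N)%N -> nm (K n) <= C.
  move=> nN; rewrite /C (bigD1 (Ordinal nN)) //= -addrA lerDl addr_ge0 //.
  by apply: sumr_ge0 => i _; exact: nm_ge0.
have PC0 : 0 < P%:R * C + 1 by rewrite ltr_wpDl // mulr_ge0 // ltW.
pose eta := e / 2 / (P%:R * C + 1); have eta0 : 0 < eta by rewrite !divr_gt0.
have small n k : (n < P)%N -> (k < P)%N ->
    (`|lambda n| + `|lambda k| + `|lambda j.+1| + `|lambda j|) * h <= 1.
  move=> nP kP; rewrite /h ler_pdivrMr ?mul1r; last lra.
  have := lamL n ltac:(lia); have := lamL k ltac:(lia).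
  have := lamL j.+1 ltac:(lia); have := lamL j ltac:(lia); lra.
have /filter_ex[M hM] : \forall M \near \oo, forall nk : 'I_N * 'I_P,
    nm (\sum_(m < M) (weight zeta h m / M%:R)%:C *
      cis ((lambda nk.1 - lambda nk.2) * h * m%:R) - target_coef zeta nk.1 nk.2) <= eta.
  apply: filter_forall => -[n k] /=.
  apply: avg_coef_cvg => //; apply: small => //.
  by apply: leq_trans (ltn_ord n) _; lia.
exists (avg zeta h M); first exact: tangent_avg.
move=> n nN; rewrite nm_distC.
have nP : (n + j + 3 <= P)%N by lia.
have -> : avg zeta h M n - target zeta n =
    \sum_(m < M) (weight zeta h m / M%:R)%:C *: (cis (lambda n * (h * m%:R)) *:
       U (- (h * m%:R)) (K n - fourier_sum ip phi P (K n))) +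
    (\sum_(m < M) (weight zeta h m / M%:R)%:C *: (cis (lambda n * (h * m%:R)) *:
       U (- (h * m%:R)) (fourier_sum ip phi P (K n))) - target zeta n).
  rewrite addrA; congr (_ - _); rewrite -big_split; apply: eq_bigr => m _ /=.
  by rewrite -!scalerDr -(isometryD _ _ (U_isom _)) subrK.
apply: le_trans (nmD _ _) _.
have h1 := le_trans (nm_avg_le h M n (K n - fourier_sum ip phi P (K n)) z1)
  (ler_wpM2l (ler0n R 2) (hP0 P (leq_maxl _ _) n nN)).
apply: le_trans (lerD h1 (lexx _)) _.
rewrite (avgE zeta h M (erefl : fourier_sum ip phi P (K n) = _)) (target_widen _ nP) -sumrB.
have h2 : nm (\sum_(k < P) ((b n k * \sum_(m < M) (weight zeta h m / M%:R)%:C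
      * cis ((lambda n - lambda k) * h * m%:R)) *: phi k -
      (b n k * target_coef zeta n k) *: phi k)) <= e / 2.
  apply: le_trans (nm_sum _ _ _) _.
  apply: (@le_trans _ _ (\sum_(k < P) C * eta)).
    apply: ler_sum => k _; rewrite -scalerBl -mulrBr nmZ (nm_phi ip_norm phi_basis) mulr1 nmM.
    apply: ler_pM; rewrite ?nm_ge0 //; last exact: (hM (Ordinal nN, k)).
    exact: le_trans (nm_coord_le ip_norm phi_basis _ _) (KC n nN).
  rewrite sumr_const card_ord -[_ *+ P]mulr_natl mulrA /eta mulrCA ler_piMr ?divr_ge0 ?ltW //.
  by rewrite ltr_pdivrMr // mul1r ltrDl.
lra.
Qed.
Lemma sum_pick (F : nat -> R[i]) p P : (p < P)%N ->
  \sum_(k < P) (F k * (p == k)%:R) *: phi k = F p *: phi p.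
Proof.
move=> pP; rewrite (bigD1 (Ordinal pP)) //= eqxx mulr1 big1 ?addr0 // => k.
by rewrite -val_eqE /= eq_sym => /negbTE ->; rewrite mulr0 scale0r.
Qed.

Lemma targetE zeta n : target zeta n = b n n *: phi n +
  (if n == j then (zeta / 2 * b j j.+1) *: phi j.+1
   else if n == j.+1 then (conjc zeta / 2 * b j.+1 j) *: phi j else 0).
Proof.
rewrite /target /target_coef; set P := (n + j + 3)%N.
rewrite (eq_bigr (fun k : 'I_P => (b n k * (n == k)%:R) *: phi k +
  (((zeta / 2 * (n == j)%:R) * b n k * (j.+1 == k)%:R) *: phi k +
   ((conjc zeta / 2 * (n == j.+1)%:R) * b n k * (j == k)%:R) *: phi k))); last first.
  move=> k _; rewrite -!scalerDl !(eq_sym (k : nat)) -!mulnb !natrM.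
  by congr (_ *: _); ring.
rewrite !big_split /= sum_pick; last by rewrite /P; lia.
rewrite (sum_pick (fun k => zeta / 2 * (n == j)%:R * b n k)); last by rewrite /P; lia.
rewrite (sum_pick (fun k => conjc zeta / 2 * (n == j.+1)%:R * b n k)); last by rewrite /P; lia.
congr (_ + _); case: eqP => [->|_].
  by rewrite (ltn_eqF (ltnSn j)) mulr1 mulr0 mul0r scale0r addr0.
rewrite mulr0 mul0r scale0r add0r; case: eqP => [->|_]; first by rewrite mulr1.
by rewrite mulr0 mul0r scale0r.
Qed.

Hypothesis K_skew : forall n k, ip (K n) (phi k) = - conjc (ip (K k) (phi n)).

(** The average with zeta = 0 is the diagonal alone, with imaginary entries since K is skew, so its
    opposite is tangent too. Adding this to an average with unimodular zeta leaves the pair (j,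
    j.+1). *)
Lemma tangent_rotation (y : R[i]) : nm y = 1 -> b j j.+1 != 0 ->
  tangent (fun n => if n == j then y *: phi j.+1
                    else if n == j.+1 then - conjc y *: phi j else 0).
Proof.
move=> y1 b0.
have bdiag n : b n n = (complex.Im (b n n)) *i.
  have := K_skew n n; rewrite -/(b n n); case: (b n n) => p q /(congr1 (@complex.Re R)) /= h.
  by apply/eqP; rewrite eq_complex /= eqxx andbT; apply/eqP; lra.
have tD : tangent (fun n => (complex.Im (b n n)) *i *: phi n).
  have := @tangent_target 0; rewrite nm0 ler01 => /(_ erefl); apply: tangent_ext => n.
  rewrite targetE conjc0 !mul0r !scale0r -bdiag.
  by case: ifP => _; [|case: ifP => _]; rewrite addr0.
have tDN := tangent_diagN ip_norm phi_basis S_id S_comp S_isom tD.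
have nb0 : 0 < nm (b j j.+1).
  by rewrite lt_neqAle nm_ge0 andbT eq_sym; apply: contra_neq b0; exact: nm0_eq0.
have nbC : (nm (b j j.+1))%:C != 0 :> R[i].
  by rewrite eq_complex /= eqxx andbT gt_eqF.
(* The phase gives zeta * b j j.+1 = y |b j j.+1|, and rescaling by 2 / |b j j.+1| then leaves
   exactly y. *)
pose zeta := y * conjc (b j j.+1) / (nm (b j j.+1))%:C.
have z1 : nm zeta <= 1.
  by rewrite /zeta -fmorphV !nmM y1 nm_conj nmR mul1r gtr0_norm ?invr_gt0 // divff ?gt_eqF.
have e1 : (2 / nm (b j j.+1))%:C * (zeta / 2 * b j j.+1) = y.
  have -> : (2 / nm (b j j.+1))%:C = 2 / (nm (b j j.+1))%:C :> R[i].
    by rewrite rmorphM fmorphV (rmorph_nat (real_complex R)).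
  have bb : b j j.+1 * conjc (b j j.+1) = (nm (b j j.+1))%:C * (nm (b j j.+1))%:C.
    by rewrite mulc_conj_nm expr2 rmorphM.
  rewrite /zeta; move: nbC bb; move: (nm _)%:C => c c0 bb.
  rewrite (_ : 2 / c * _ = y * (b j j.+1 * conjc (b j j.+1)) / (c * c)); last by field.
  by rewrite bb mulfK // mulf_neq0.
have c0 : 0 < 2 / nm (b j j.+1) by rewrite divr_gt0.
apply: (tangent_ext _ (tangentZ c0
  (tangentD ip_norm phi_basis S_comp S_isom (tangent_target z1) tDN))) => n.
rewrite targetE {1}bdiag.
have -> : (- complex.Im (b n n)) *i = - ((complex.Im (b n n)) *i).
  by apply/eqP; rewrite eq_complex /= oppr0 !eqxx.
rewrite addrAC scaleNr subrr add0r.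
case: ifP => _; first by rewrite scalerA e1.
case: ifP => _; last by rewrite scaler0.
have conj_eq (r : R) (z w : R[i]) :
    r%:C * (conjc z / 2 * - conjc w) = - conjc (r%:C * (z / 2 * w)).
  by rewrite !conjcM conjc_real conjc_inv conjc_nat; ring.
by rewrite scalerA; congr (_ *: _); rewrite -e1 -conj_eq /b -K_skew.
Qed.
End averaging.

(** * Planar rotations *)

Section reachability.
Variables (R : realType) (H : completeNormedModType R[i]).
Variable ip : {dot H for Num.conj}.
Hypothesis ip_norm : hilbert_norm ip.
Variable phi : nat -> H.
Hypothesis phi_basis : orthonormal_basis ip phi.
Variable S : set (H -> H).
Hypothesis S_id : S id.
Hypothesis S_comp : forall V W, S V -> S W -> S (V \o W).
Hypothesis S_isom : forall W, S W -> linear_isometry W.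
Hypothesis rotations : forall j (y : R[i]), nm y = 1 ->
  tangent phi S (fun n => if n == j then y *: phi j.+1
                          else if n == j.+1 then - conjc y *: phi j else 0).

Definition reach (x y : H) : Prop :=
  forall e : R, 0 < e -> exists2 W, S W & nm (W x - y) <= e.

Lemma reach_trans y x z : reach x y -> reach y z -> reach x z.
Proof.
move=> xy yz e e0; have e2 : 0 < e / 2 by rewrite divr_gt0.
have [V SV Vx] := xy _ e2; have [W SW Wy] := yz _ e2.
exists (W \o V); first exact: S_comp.
apply: le_trans (nm_distD (W y) _ _) _ => /=.
rewrite -(isometryB _ _ (S_isom SW)) (S_isom SW).2; lra.
Qed.

Lemma reach_nm x y : reach x y -> nm y = nm x.
Proof.
move=> xy; apply/eqP; rewrite eq_le; apply/andP; split; apply: ler_eps => e e0;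
  have [W SW Wx] := xy e e0; have := (S_isom SW).2 x; have := nm_distB y (W x);
  have := nm_distB (W x) y; rewrite (nm_distC y); lra.
Qed.

(** At c = cos t and s = sin t, these are the coordinates at time t of the solution of x' = K x that
    starts at a, for the generator K of [rotations]. *)
Let rotated j (c s : R) (y : R[i]) (a : nat -> R[i]) k : R[i] :=
  if k == j then c%:C * a j - conjc y * s%:C * a j.+1
  else if k == j.+1 then y * s%:C * a j + c%:C * a j.+1 else a k.

Lemma sum_split2 (F : nat -> H) j N : (j.+1 < N)%N ->
  \sum_(k < N) F k =
  F j + (F j.+1 + \sum_(k < N | (k != j :> nat) && (k != j.+1 :> nat)) F k).
Proof.
move=> jN; rewrite (bigD1 (Ordinal (ltnW jN))) //= (bigD1 (Ordinal jN)) //=.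
by rewrite -val_eqE /= gtn_eqF.
Qed.

Lemma reach_rotation j N (a : nat -> R[i]) (y : R[i]) (t : R) :
  (j.+1 < N)%N -> nm y = 1 -> 0 <= t ->
  reach (\sum_(k < N) a k *: phi k)
        (\sum_(k < N) rotated j (cos t) (sin t) y a k *: phi k).
Proof.
move=> jN y1 t0 e e0.
have yy : y * conjc y = 1 by rewrite mulc_conj_nm y1 expr1n.
pose c (_ : nat) (r : R) k := rotated j (cos r) (sin r) y a k.
pose M := nm (a j) + nm (a j.+1); have M0 : 0 <= M by rewrite addr_ge0 ?nm_ge0.
pose B := M + \sum_(k < N) nm (a k).
have sN0 : 0 <= \sum_(k < N) nm (a k) by apply: sumr_ge0 => k _; exact: nm_ge0.
have B0 : 0 <= B by rewrite addr_ge0.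
have nm_cos (r : R) : nm (cos r)%:C <= 1.
  by rewrite nmR ler_norml cos_geN1 cos_le1.
have nm_sin (r : R) : nm (sin r)%:C <= 1.
  by rewrite nmR ler_norml sin_geN1 sin_le1.
have le1M (u v : R[i]) : nm u <= 1 -> nm (u * v) <= nm v.
  by move=> u1; rewrite nmM ler_piMl ?nm_ge0.
have cj r : nm (c 0%N r j) <= M.
  rewrite /c /rotated eqxx; apply: le_trans (nmD _ _) _; rewrite nmN.
  by apply: lerD; rewrite -?mulrA ?le1M // nmM nm_conj y1 mul1r le1M.
have cj1 r : nm (c 0%N r j.+1) <= M.
  rewrite /c /rotated eqxx (gtn_eqF (ltnSn j)); apply: le_trans (nmD _ _) _.
  by apply: lerD; rewrite -?mulrA ?le1M // nmM y1 mul1r le1M.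
have cB (i : nat) r k : (k < N)%N -> nm (c i r k) <= B.
  move=> kN; have [->|kj] := eqVneq k j; first by apply: le_trans (cj r) _; rewrite /B lerDl.
  have [->|kj1] := eqVneq k j.+1; first by apply: le_trans (cj1 r) _; rewrite /B lerDl.
  rewrite /c /rotated (negbTE kj) (negbTE kj1) /B (bigD1 (Ordinal kN)) //=.
  rewrite addrCA lerDl addr_ge0 //; apply: sumr_ge0 => i' _; exact: nm_ge0.
pose K n := if n == j then y *: phi j.+1
            else if n == j.+1 then - conjc y *: phi j else 0.
have step (e1 : R) : 0 < e1 -> exists2 s0 : R, 0 < s0 & forall s, 0 < s -> s < s0 ->
     forall r i, (i < 1)%N ->
     nm (\sum_(k < N) c i (r + s) k *: phi k -
         \sum_(k < N) c i r k *: (phi k + s%:C *: K k)) <= e1 * s.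
  move=> e10; have M4 : 0 < 4 * M + 1 by lra.
  have [d d0 dP] := cis_approx (divr_gt0 e10 M4).
  exists d => // s s0 sd r i _.
  pose rest := \sum_(k < N | (k != j :> nat) && (k != j.+1 :> nat)) a k *: phi k.
  rewrite (sum_split2 (fun k => c i (r + s) k *: phi k) jN).
  rewrite (sum_split2 (fun k => c i r k *: (phi k + s%:C *: K k)) jN).
  rewrite (_ : \sum_(k < N | _) c i (r + s) k *: phi k = rest); last first.
    by apply: eq_bigr => k /andP[k1 k2]; rewrite /c /rotated (negbTE k1) (negbTE k2).
  rewrite (_ : \sum_(k < N | _) c i r k *: (phi k + s%:C *: K k) = rest); last first.
    apply: eq_bigr => k /andP[k1 k2]; rewrite /c /rotated /K (negbTE k1) (negbTE k2).
    by rewrite scaler0 addr0.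
  have -> : K j = y *: phi j.+1 by rewrite /K eqxx.
  have -> : K j.+1 = - conjc y *: phi j by rewrite /K (gtn_eqF (ltnSn j)) eqxx.
  set p := c i r j; set q := c i r j.+1.
  have np : nm p <= M := cj r. have nq : nm q <= M := cj1 r.
  have cosDC : (cos (r + s))%:C = (cos r)%:C * (cos s)%:C - (sin r)%:C * (sin s)%:C.
    by rewrite cosD -!rmorphM -rmorphB.
  have sinDC : (sin (r + s))%:C = (sin r)%:C * (cos s)%:C + (cos r)%:C * (sin s)%:C.
    by rewrite sinD -!rmorphM -rmorphD.
  have ep : c i (r + s) j = (cos s)%:C * p - conjc y * (sin s)%:C * q.
    rewrite /p /q /c /rotated eqxx (gtn_eqF (ltnSn j)) eqxx cosDC sinDC.
    transitivity (((cos r)%:C * (cos s)%:C - y * conjc y * (sin r)%:C * (sin s)%:C) * a j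
      - conjc y * ((sin r)%:C * (cos s)%:C + (cos r)%:C * (sin s)%:C) * a j.+1).
      by rewrite yy mul1r.
    ring.
  have eq : c i (r + s) j.+1 = y * (sin s)%:C * p + (cos s)%:C * q.
    rewrite /p /q /c /rotated eqxx (gtn_eqF (ltnSn j)) eqxx cosDC sinDC.
    transitivity (y * ((sin r)%:C * (cos s)%:C + (cos r)%:C * (sin s)%:C) * a j
      + ((cos r)%:C * (cos s)%:C - y * conjc y * (sin r)%:C * (sin s)%:C) * a j.+1).
      by rewrite yy mul1r.
    ring.
  rewrite ep eq.
  have -> : ((cos s)%:C * p - conjc y * (sin s)%:C * q) *: phi j +
    ((y * (sin s)%:C * p + (cos s)%:C * q) *: phi j.+1 + rest) -
    (p *: (phi j + s%:C *: (y *: phi j.+1)) +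
     (q *: (phi j.+1 + s%:C *: (- conjc y *: phi j)) + rest)) =
    ((cos s - 1)%:C * p - conjc y * ((sin s - s)%:C * q)) *: phi j +
    (y * ((sin s - s)%:C * p) + (cos s - 1)%:C * q) *: phi j.+1.
    have -> : (cos s - 1)%:C = (cos s)%:C - 1 by exact: rmorphB.
    have -> : (sin s - s)%:C = (sin s)%:C - s%:C by exact: rmorphB.
    by module_eq R[i] H.
  have ds : `|s| < d by rewrite gtr0_norm.
  (* Only the remainders cos s - 1 and sin s - s are left, both bounded by D = |cis s - (1 + i s)|,
     which is o(s). They occur in four products, each at most M D. *)
  have := dP s ds; set D := nm _ => Ds.
  have cosD1 : nm (cos s - 1)%:C <= D.
    by rewrite nmR /D; apply: le_trans (normRe_le_nm _); rewrite /= addr0.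
  have sinD1 : nm (sin s - s)%:C <= D.
    by rewrite nmR /D nmCE /= add0r -sqrtr_sqr ler_wsqrtr // lerDr sqr_ge0.
  have D0 : 0 <= D by exact: nm_ge0.
  have two (u v w z : R[i]) : nm w <= D -> nm z <= D -> nm u <= M -> nm v <= M ->
      nm (w * u) + nm (z * v) <= 2 * M * D.
    move=> hw hz hu hv; rewrite !nmM.
    have := ler_pM (nm_ge0 _) (nm_ge0 _) hw hu; have := ler_pM (nm_ge0 _) (nm_ge0 _) hz hv.
    lra.
  apply: le_trans (nmD _ _) _; rewrite !nmZ !(nm_phi ip_norm phi_basis) !mulr1.
  apply: le_trans (lerD (nmD _ _) (nmD _ _)) _; rewrite nmN.
  rewrite (nmM (conjc y)) (nmM y) nm_conj y1 !mul1r.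
  have := lerD (two _ _ _ _ cosD1 sinD1 np nq) (two _ _ _ _ sinD1 cosD1 np nq).
  move=> /le_trans; apply; rewrite gtr0_norm // in Ds.
  apply: (@le_trans _ _ ((4 * M + 1) * (e1 / (4 * M + 1) * s))); last first.
    by rewrite mulrA [_ * (e1 / _)]mulrC divfK // gt_eqF.
  have := ler_wpM2l (ltW M4) Ds; lra.
have [W SW WP] := tangent_flow S_id S_comp S_isom (rotations j y1) B0 cB step t0 e0.
exists W => //; have := WP 0%N erefl.
rewrite (eq_bigr (fun k : 'I_N => a k *: phi k)) // => k _.
rewrite /c /rotated cos0 sin0 !mulr0 !mul0r subr0 add0r !mul1r.
by case: eqP => [->//|_]; case: eqP => [->|].
Qed.

(** The angle is acos c, whose sine is nonnegative; a negative s is obtained through the phase y. *)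
Lemma reach_rotation_cs j N (a : nat -> R[i]) (y : R[i]) (c s : R) :
  (j.+1 < N)%N -> nm y = 1 -> 0 <= s -> c ^+ 2 + s ^+ 2 = 1 ->
  reach (\sum_(k < N) a k *: phi k) (\sum_(k < N) rotated j c s y a k *: phi k).
Proof.
move=> jN y1 s0 cs1.
have c1 : -1 <= c <= 1.
  have s2 := sqr_ge0 s; apply/andP; split; nra.
have -> : s = sin (acos c).
  by rewrite sin_acos // (_ : 1 - c ^+ 2 = s ^+ 2) ?sqrtr_sqr ?ger0_norm //; lra.
rewrite -{1}(acosK c1); apply: reach_rotation => //.
by have := acos_ge0 c1.
Qed.

Definition equireach x y : Prop := reach x y /\ reach y x.

Lemma equireach_trans y x z : equireach x y -> equireach y z -> equireach x z.
Proof. by move=> [xy yx] [yz zy]; split; [exact: reach_trans xy yz|exact: reach_trans zy yx]. Qed.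

(** The inverse rotation has the same c and s and the phase - y, hence is itself reachable although
    S is only a semigroup. *)
Lemma equireach_rotation j N (a : nat -> R[i]) (y : R[i]) (c s : R) :
  (j.+1 < N)%N -> nm y = 1 -> 0 <= s -> c ^+ 2 + s ^+ 2 = 1 ->
  equireach (\sum_(k < N) a k *: phi k) (\sum_(k < N) rotated j c s y a k *: phi k).
Proof.
move=> jN y1 s0 cs1; split; first exact: reach_rotation_cs.
have yN1 : nm (- y) = 1 by rewrite nmN.
have := reach_rotation_cs (rotated j c s y a) jN yN1 s0 cs1.
rewrite [X in reach _ X](eq_bigr (fun k : 'I_N => a k *: phi k)) // => k _; congr (_ *: _).
have yy : y * conjc y = 1 by rewrite mulc_conj_nm y1 expr1n.
have ccss : c%:C * c%:C + s%:C * s%:C = 1 by rewrite -!rmorphM -rmorphD -!expr2 cs1.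
have conjN : conjc (- y) = - conjc y by exact: rmorphN.
rewrite /rotated conjN; case: eqP => [->|_].
  rewrite eqxx (gtn_eqF (ltnSn j)) eqxx.
  transitivity ((c%:C * c%:C + (y * conjc y) * (s%:C * s%:C)) * a j); first by ring.
  by rewrite yy mul1r ccss mul1r.
case: eqP => [->|_ //].
rewrite eqxx (gtn_eqF (ltnSn j)) eqxx.
transitivity ((c%:C * c%:C + (y * conjc y) * (s%:C * s%:C)) * a j.+1); first by ring.
by rewrite yy mul1r ccss mul1r.
Qed.

(** A complex Givens rotation: c = |p| / r and s = |q| / r with r^2 = |p|^2 + |q|^2, while y aligns
    the phase of p with that of - q. *)
Lemma rotation_kill (p q : R[i]) : exists c s y,
  [/\ 0 <= s, c ^+ 2 + s ^+ 2 = 1, nm y = 1 & y * s%:C * p + c%:C * q = 0].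
Proof.
have [->|q0] := eqVneq q 0.
  by exists 1, 0, 1; split; rewrite ?nm1 // ?expr1n ?expr0n /= ?addr0 // !mulr0 mul0r addr0.
have [->|p0] := eqVneq p 0.
  by exists 0, 1, 1; split; rewrite ?nm1 // ?expr1n ?expr0n /= ?add0r // !mulr0 mul0r addr0.
have np : 0 < nm p.
  by rewrite lt_neqAle nm_ge0 andbT eq_sym; apply: contra_neq p0; exact: nm0_eq0.
have nq : 0 < nm q.
  by rewrite lt_neqAle nm_ge0 andbT eq_sym; apply: contra_neq q0; exact: nm0_eq0.
pose r := Num.sqrt (nm p ^+ 2 + nm q ^+ 2).
have r2 : r ^+ 2 = nm p ^+ 2 + nm q ^+ 2 by rewrite sqr_sqrtr // addr_ge0 ?sqr_ge0.
have r0 : 0 < r by rewrite sqrtr_gt0 addr_gt0 ?exprn_gt0.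
have realC_neq0 (u : R) : 0 < u -> u%:C != 0 :> R[i].
  by move=> u0; rewrite eq_complex /= eqxx andbT gt_eqF.
have nmV (z : R[i]) : z != 0 -> nm z^-1 = (nm z)^-1.
  move=> z0; apply: (mulfI (x := nm z)); last by rewrite -nmM !divff ?nm1 //;
    apply: contra_neq z0; exact: nm0_eq0.
  by apply: contra_neq z0; exact: nm0_eq0.
exists (nm p / r), (nm q / r), (- (q * (nm p)%:C) / (p * (nm q)%:C)); split.
- by rewrite divr_ge0 ?nm_ge0 ?ltW.
- by rewrite !expr_div_n -mulrDl -r2 divff // expf_neq0 // gt_eqF.
- rewrite !(nmM, nmN) nmV ?mulf_neq0 ?realC_neq0 // !nmM !nmR !gtr0_norm //.
  by rewrite mulrC [nm q * _]mulrC mulVf // mulf_neq0 // gt_eqF.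
- have divC (u v : R) : (u / v)%:C = u%:C / v%:C :> R[i] by rewrite rmorphM fmorphV.
  by rewrite !divC; field; rewrite p0 !realC_neq0.
Qed.

(** Givens elimination removes the last coordinate until only a unimodular multiple of [phi 0] is
    left. *)
Lemma equireach_phi1 N (a : nat -> R[i]) : nm (\sum_(k < N.+1) a k *: phi k) = 1 ->
  equireach (\sum_(k < N.+1) a k *: phi k) (phi 1%N).
Proof.
elim: N a => [|N IH] a.
  rewrite !big_ord_recr big_ord0 /= add0r nmZ (nm_phi ip_norm phi_basis) mulr1 => a1.
  pose a' k := if k == 0%N then a 0%N else 0.
  (* A quarter turn with phase conjc (a 0) carries [a 0 *: phi 0] to [phi 1] and absorbs the
     remaining phase; this is why the common target is [phi 1]. *)
  have := @equireach_rotation 0 2 a' (conjc (a 0%N)) 0 1.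
  rewrite nm_conj a1 ler01 expr1n expr0n /= add0r => /(_ erefl erefl erefl erefl).
  rewrite !big_ord_recr !big_ord0 /= /rotated /a' /= !add0r !mulr0 !mul0r subrr !scale0r.
  by rewrite add0r addr0 addr0 mulr1 mulrC mulc_conj_nm a1 expr1n scale1r.
move=> a1; have [c [s [y [s0 cs1 y1 kill]]]] := rotation_kill (a N) (a N.+1).
have aa' := @equireach_rotation N N.+2 a y c s (ltnSn _) y1 s0 cs1.
have drop_last : \sum_(k < N.+2) rotated N c s y a k *: phi k =
    \sum_(k < N.+1) rotated N c s y a k *: phi k.
  rewrite big_ord_recr /= [X in _ + X *: _](_ : _ = 0) ?scale0r ?addr0 //.
  by rewrite /rotated (gtn_eqF (ltnSn N)) eqxx.
rewrite drop_last in aa'; apply: equireach_trans (aa') _.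
by apply: IH; rewrite (reach_nm aa'.1).
Qed.

Lemma finite_unit_approx (x : H) (e : R) : nm x = 1 -> 0 < e ->
  exists N (a : nat -> R[i]), nm (\sum_(k < N.+1) a k *: phi k) = 1 /\
    nm (x - \sum_(k < N.+1) a k *: phi k) <= e.
Proof.
(* The bound 1 / 2 keeps the truncation nonzero, so that it can be normalized; normalizing costs
   another e / 2. *)
move=> x1 e0; have e2 : 0 < Num.min (e / 2) (1 / 2) by rewrite lt_min !divr_gt0.
have [N /(_ N.+1 (leqnSn N))] := fourier_sum_approx ip_norm phi_basis x e2.
set v := fourier_sum _ _ _ _; rewrite le_min => /andP[xe xh].
have v0 : 0 < nm v by have := nm_distB x v; rewrite x1; lra.
exists N, (fun k => (nm v)^-1%:C * ip x (phi k)).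
have -> : \sum_(k < N.+1) ((nm v)^-1%:C * ip x (phi k)) *: phi k = (nm v)^-1%:C *: v.
  by rewrite /v /fourier_sum scaler_sumr; apply: eq_bigr => k _; rewrite scalerA.
split; first by rewrite nmZr gtr0_norm ?invr_gt0 // mulVf // gt_eqF.
apply: le_trans (nm_distD v _ _) _.
have -> : v - (nm v)^-1%:C *: v = (1 - (nm v)^-1)%:C *: v.
  by rewrite rmorphB scalerBl scale1r.
rewrite nmZr -{2}(gtr0_norm v0) -normrM mulrBl mul1r mulVf ?gt_eqF //.
have h1 := nm_distB x v; have h2 := nm_distB v x; rewrite (nm_distC v) x1 in h2 h1.
have : `|nm v - 1| <= e / 2 by rewrite ler_norml; apply/andP; split; lra.
lra.
Qed.

Lemma reach_unit x y : nm x = 1 -> nm y = 1 -> reach x y.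
Proof.
move=> x1 y1 e e0; have e3 : 0 < e / 3 by rewrite divr_gt0.
have [N [a [a1 xa]]] := finite_unit_approx x1 e3.
have [M [b [b1 yb]]] := finite_unit_approx y1 e3.
have [_ +] := equireach_phi1 b1; have [+ _] := equireach_phi1 a1.
move=> /reach_trans/[apply]/(_ _ e3)[W SW Wab]; exists W => //.
set u := \sum_(k < N.+1) _ in xa Wab; set v := \sum_(k < M.+1) _ in yb Wab.
have -> : W x - y = W (x - u) + (W u - v) - (y - v).
  by rewrite (isometryB _ _ (S_isom SW)); module_eq R[i] H.
apply: le_trans (nmD _ _) _; apply: le_trans (lerD (nmD _ _) (lexx _)) _.
rewrite nmN (S_isom SW).2; lra.
Qed.

End reachability.

(** * Controllability *)

Section independent_gaps.
Variables (R : realType) (lambda : nat -> R).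
Hypothesis indep : Q_linearly_independent (fun i => lambda i.+1 - lambda i).

Lemma int_independent N (q : nat -> int) :
  \sum_(i < N) (q i)%:~R * (lambda i.+1 - lambda i) = 0 ->
  forall i, (i < N)%N -> q i = 0.
Proof.
move=> sum0 i iN; apply/eqP/negP => /negP q0.
have qi : exists l : 'I_N, (q l)%:~R != 0 :> rat by exists (Ordinal iN); rewrite intr_eq0.
have := @indep N (fun l => (q l)%:~R) qi; rewrite -[X in _ != X]sum0.
by case/eqP; apply: eq_bigr => l _; rewrite ratr_int.
Qed.

Lemma lambda_telescope N m : (m <= N)%N -> lambda m - lambda 0%N =
  \sum_(i < N) (i < m)%:R * (lambda i.+1 - lambda i).
Proof.
move=> mN; rewrite -telescope_sumr // big_mkord.
rewrite (big_ord_widen N (fun i => lambda i.+1 - lambda i)) // big_mkcond.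
by apply: eq_bigr => i _; case: ifP => _; rewrite ?mul1r ?mul0r.
Qed.

(** Each lambda m - lambda 0 is the sum of the gaps i < m, so a coincidence of differences is an
    integer relation between gaps and all its coefficients vanish. Terms are moved across the
    equality to avoid truncated subtraction. *)
Lemma lambda_indicators n k m l : lambda n - lambda k = lambda m - lambda l ->
  forall i, ((i < n) + (i < l) = (i < k) + (i < m))%N.
Proof.
move=> nkml i; pose N := (n + k + m + l + i).+1.
have sum0 : \sum_(i < N) (((i < n)%:Z + (i < l)%:Z) - ((i < k)%:Z + (i < m)%:Z))%:~R *
    (lambda i.+1 - lambda i) = 0.
  have := lambda_telescope (_ : n <= N)%N; have := lambda_telescope (_ : k <= N)%N.
  have := lambda_telescope (_ : m <= N)%N; have := lambda_telescope (_ : l <= N)%N.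
  move=> /(_ ltac:(lia)) hl /(_ ltac:(lia)) hm /(_ ltac:(lia)) hk /(_ ltac:(lia)) hn.
  have : (lambda n - lambda 0%N) + (lambda l - lambda 0%N)
     - ((lambda k - lambda 0%N) + (lambda m - lambda 0%N)) = 0.
    by move: nkml; lra.
  rewrite hl hm hk hn -!big_split /= -sumrB => e; rewrite -[RHS]e; apply: eq_bigr => p _.
  by rewrite rmorphB !rmorphD /= -!pmulrn; ring.
pose q i := ((i < n)%:Z + (i < l)%:Z) - ((i < k)%:Z + (i < m)%:Z).
have := @int_independent N q sum0 i ltac:(lia); rewrite /q; lia.
Qed.

Lemma lambda_injective n k : lambda n = lambda k -> n = k.
Proof.
move=> nk; have h := @lambda_indicators n k 0 0.
rewrite nk !subrr in h; have := h erefl n; have := h erefl k; lia.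
Qed.

Lemma lambda_gap j n k : lambda n - lambda k = lambda j.+1 - lambda j ->
  n = j.+1 /\ k = j.
Proof.
move=> /lambda_indicators h; have := h j; have := h n.-1; have := h k; lia.
Qed.

End independent_gaps.

(** * Reachable operators of the control system *)

Section control_semigroup.
Variables (R : realType) (H : completeNormedModType R[i]).
Variable ip : {dot H for Num.conj}.
Hypothesis ip_norm : hilbert_norm ip.
Variables (delta : R) (A B : operator H) (phi : nat -> H) (lambda : nat -> R).
Hypothesis delta_gt0 : 0 < delta.
Hypothesis sys : discrete_spectrum_system ip A B phi.
Hypothesis ext : unique_extensions ip A B phi `]0, delta[.
Hypothesis eig : forall n, A (phi n) = ((lambda n) *i) *: phi n.

Definition reachable_map (W : H -> H) : Prop :=
  exists2 s : seq (R * R), (forall p, p \in s -> 0 < p.1 /\ `]0, delta[%classic p.2) &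
    forall x, W x = propagate ip A B phi s x.

Lemma phi_basis : orthonormal_basis ip phi.
Proof. by case: sys. Qed.

Lemma phi_span n : finite_span phi (phi n).
Proof.
exists n.+1, (fun k => (k == ord_max)%:R); rewrite (bigD1 ord_max) //= eqxx scale1r.
by rewrite big1 ?addr0 // => k /negbTE ->; rewrite scale0r.
Qed.

Lemma perturbed_extension u : `]0, delta[%classic u ->
  skew_adjoint_extension ip A B phi u (perturbed ip A B phi u).
Proof.
move=> /ext[C [CP _]]; rewrite /perturbed.
by case: xgetP => [_ -> //|/(_ C)[]].
Qed.

Lemma perturbed_generates u : `]0, delta[%classic u ->
  generates ip (perturbed ip A B phi u) (expop ip (perturbed ip A B phi u)).
Proof. by move=> /perturbed_extension[skewC _]; exact: expop_generates. Qed.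

Lemma reachable_map_isometry W : reachable_map W -> linear_isometry W.
Proof.
case=> s sU /funext -> {W}; elim/last_ind: s sU => [_|s [t u] IH sU].
  exact: isometry_id.
have -> : propagate ip A B phi (rcons s (t, u)) =
    expop ip (perturbed ip A B phi u) t \o propagate ip A B phi s.
  by apply/funext => x; rewrite /propagate foldl_rcons.
apply: isometry_comp; last first.
  by apply: IH => p ps; apply: sU; rewrite mem_rcons inE ps orbT.
have [_ /= uU] := sU (t, u) ltac:(by rewrite mem_rcons inE eqxx).
have [[Tu _ _ _] _] := perturbed_generates uU.
exact: (unitary_isometry ip_norm (Tu t)).
Qed.

Lemma reachable_map_id : reachable_map id.
Proof. by exists [::]. Qed.

Lemma reachable_map_comp V W :
  reachable_map V -> reachable_map W -> reachable_map (V \o W).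
Proof.
(* [propagate] applies the head of the list first, so the controls of the inner operator come
   first. *)
move=> [s sU sV] [s' sU' sW]; exists (s' ++ s) => [p|x /=].
  by rewrite mem_cat => /orP[/sU'|/sU].
by rewrite /propagate foldl_cat sV sW.
Qed.

Lemma reachable_map_step t u : 0 < t -> `]0, delta[%classic u ->
  reachable_map (expop ip (perturbed ip A B phi u) t).
Proof. by move=> t0 uU; exists [:: (t, u)] => // p; rewrite inE => /eqP ->. Qed.

Lemma tangent_perturbed u : `]0, delta[%classic u ->
  tangent phi reachable_map (fun n => A (phi n) + u%:C *: B (phi n)).
Proof.
move=> uU N e e0; pose C := perturbed ip A B phi u; pose T := expop ip C.
have [d d0 dP] : exists2 d : R, 0 < d & forall t, `|t| < d -> forall n, (n < N)%N ->
    nm (T t (phi n) - (phi n + t%:C *: (A (phi n) + u%:C *: B (phi n)))) <= e * `|t|.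
  elim: N => [|N [d1 d10 d1P]]; first by exists 1.
  have [_ /(_ _ (phi_span N))[dN CN]] := perturbed_extension uU.
  have [d2 d20 d2P] := generates_diff (perturbed_generates uU) dN e0.
  exists (Num.min d1 d2) => [|t]; first by rewrite lt_min d10.
  rewrite lt_min => /andP[td1 td2] n; rewrite ltnS leq_eqVlt => /predU1P[->|].
    by rewrite -CN; exact: d2P.
  exact: d1P.
exists d => // t t0 td; exists (T t); first exact: reachable_map_step.
by move=> n nN; have := dP t; rewrite gtr0_norm // => /(_ td n nN).
Qed.

Lemma half_delta : `]0, delta[%classic (delta / 2).
Proof. by rewrite /= in_itv /= divr_gt0 //= ltr_pdivrMr // ltr_pMr // ltr1n. Qed.

Lemma tangent_drift : tangent phi reachable_map (fun n => (lambda n) *i *: phi n).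
Proof.
apply: tangent_lim => N e e0; pose M := \sum_(n < N) nm (B (phi n)).
have M0 : 0 <= M by apply: sumr_ge0 => n _; exact: nm_ge0.
have M1 : 0 < M + 1 by lra.
(* The control 0 is not admissible, so the drift is only a limit: u stays inside the open interval
   while u B is below e on the first N vectors. *)
pose u := Num.min (delta / 2) (e / (M + 1)).
have u0 : 0 < u by rewrite lt_min !divr_gt0.
have uU : `]0, delta[%classic u.
  by rewrite /= in_itv /= u0 /u gt_min; have := half_delta; rewrite /= in_itv /= => /andP[_ ->].
exists (fun n => A (phi n) + u%:C *: B (phi n)); first exact: tangent_perturbed.
move=> n nN; rewrite eig opprD addrA subrr add0r nmN nmZr gtr0_norm //.
have BM : nm (B (phi n)) <= M.
  by rewrite /M (bigD1 (Ordinal nN)) //= lerDl; apply: sumr_ge0 => k _; exact: nm_ge0.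
have : u <= e / (M + 1) by rewrite /u ge_min lexx orbT.
rewrite ler_pdivlMr //; apply: le_trans.
by rewrite ler_wpM2l ?(ltW u0) //; lra.
Qed.

Lemma tangent_control : tangent phi reachable_map (fun n => B (phi n)).
Proof.
have tN := tangent_diagN ip_norm phi_basis reachable_map_id reachable_map_comp
  reachable_map_isometry tangent_drift.
have d20 : 0 < delta / 2 by rewrite divr_gt0.
have c0 : 0 < (delta / 2)^-1 by rewrite invr_gt0.
apply: (tangent_ext _ (tangentZ c0 (tangentD ip_norm phi_basis reachable_map_comp
  reachable_map_isometry (tangent_perturbed half_delta) tN))) => n.
have -> : (- lambda n) *i = - ((lambda n) *i).
  by apply/eqP; rewrite eq_complex /= oppr0 !eqxx.
rewrite eig addrAC scaleNr subrr add0r scalerA -rmorphM mulVf ?scale1r //.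
by rewrite gt_eqF.
Qed.

Lemma drift_generates : generates ip A (expop ip A).
Proof. by case: sys => skewA _ _ _ _; exact: expop_generates. Qed.

Lemma expop_drift_isometry s : linear_isometry (expop ip A s).
Proof. by have [[Ts _ _ _] _] := drift_generates; exact: (unitary_isometry ip_norm (Ts s)). Qed.

(** [generates] describes the group near time 0 only. Cutting s into m.+1 equal steps, [nm_iter_sub]
    compares the iterates of e^{tA} and of multiplication by cis (lambda n t), whose one-step
    difference is o(t). *)
Lemma expop_drift_phi s n : expop ip A s (phi n) = cis (lambda n * s) *: phi n.
Proof.
have [[_ T0 TD _] _] := drift_generates; set T := expop ip A in T0 TD *.
have [_ _ _ /(_ n)[_ dn _] _] := sys.
apply/eqP; rewrite -subr_eq0; apply/eqP.
apply: (@nm_small_mul _ _ _ ((1 + `|lambda n|) * `|s|)) => e e0.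
have [d1 d10 d1P] := generates_diff drift_generates dn e0.
have [d2 d20 d2P] := cis_approx e0.
(* D strictly exceeds both |s| and |lambda n| |s|, so one m puts t and lambda n * t within the radii
   d1 and d2. *)
pose D := `|s| * (1 + `|lambda n|) + 1.
have D0 : 0 < D by rewrite ltr_wpDl // mulr_ge0 // addr_ge0.
have q0 : 0 < Num.min d1 d2 / D by rewrite divr_gt0 // lt_min d10.
have [m /(_ m (leqnn m))] := inv_le_near q0.
pose t := s * m.+1%:R^-1; rewrite ler_pdivlMr // mulrC => mD.
have i0 : 0 < m.+1%:R^-1 :> R by rewrite invr_gt0.
have tE : `|t| = `|s| * m.+1%:R^-1 by rewrite normrM (gtr0_norm i0).
have : D * m.+1%:R^-1 <= d1 /\ D * m.+1%:R^-1 <= d2.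
  by move: mD; rewrite le_min => /andP.
have l0 := normr_ge0 (lambda n); have s0 := normr_ge0 s.
have sD : `|s| < D by rewrite /D; nra.
have lsD : `|lambda n| * `|s| < D by rewrite /D; nra.
move=> [Dd1 Dd2].
have td1 : `|t| < d1 by apply: lt_le_trans Dd1; rewrite tE ltr_pM2r.
have td2 : `|lambda n * t| < d2.
  by apply: lt_le_trans Dd2; rewrite normrM tE mulrA ltr_pM2r.
have ts : t * m.+1%:R = s by rewrite /t mulfVK // pnatr_eq0.
have iterT k x : iter k (T t) x = T (t * k%:R) x.
  elim: k => [|k IH]; first by rewrite mulr0 T0.
  by rewrite iterS IH -TD -natr1 mulrDr mulr1 addrC.
pose G (x : H) := cis (lambda n * t) *: x.
have iterG k x : iter k G x = cis (lambda n * (t * k%:R)) *: x.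
  elim: k => [|k IH]; first by rewrite !mulr0 cis0 scale1r.
  rewrite iterS IH /G scalerA -cisD; congr (cis _ *: _); rewrite -natr1; ring.
have Ti := expop_drift_isometry t; rewrite -/T in Ti.
have := @nm_iter_sub _ _ (T t) G m.+1 (phi n) (fun y z => isometryB y z Ti).
rewrite iterT iterG ts => /(_ (fun y z => scalerBr _ y z)) h.
have Tn y : nm (T t y) <= nm y by rewrite Ti.2.
have {}h := h Tn.
have Gn y : nm (G y) <= nm y by rewrite /G nmZ nm_cis mul1r.
have {}h := h Gn (fun y => isometryZ _ y Ti).
apply: le_trans h _.
have step : nm (T t (phi n) - G (phi n)) <= e * ((1 + `|lambda n|) * `|t|).
  apply: le_trans (nm_distD (phi n + t%:C *: A (phi n)) _ _) _.
  rewrite mulrDl mul1r mulrDr; apply: lerD; first exact: d1P.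
  rewrite -normrM; apply: le_trans (d2P _ td2); rewrite eig.
  have -> : phi n + t%:C *: ((lambda n) *i *: phi n) - G (phi n) =
      - (cis (lambda n * t) - (1 + (lambda n * t) *i)) *: phi n.
    rewrite (_ : (lambda n * t) *i = t%:C * (lambda n) *i) /G; last first.
      by apply/eqP; rewrite eq_complex /=; apply/andP; split; apply/eqP; ring.
    by module_eq R[i] H.
  by rewrite nmZ nmN (nm_phi ip_norm phi_basis) mulr1.
apply: le_trans (ler_wpM2l (ler0n R m.+1) step) _.
have -> : `|s| = `|t| * m.+1%:R by rewrite -{1}ts normrM [`|m.+1%:R|]ger0_norm.
by rewrite le_eqVlt; apply/orP; left; apply/eqP; ring.
Qed.

Lemma drift_approachable s : approachable phi reachable_map (expop ip A s \o phi).
Proof.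
have h := approachable_diag ip_norm phi_basis reachable_map_id reachable_map_comp
  reachable_map_isometry tangent_drift s.
move=> N e e0; have [W SW WP] := h N e e0; exists W => // n nN /=.
by rewrite expop_drift_phi; exact: WP.
Qed.

Lemma control_skew n k : ip (B (phi n)) (phi k) = - conjc (ip (B (phi k)) (phi n)).
Proof.
case: sys => _ skewB _ _ dB.
by rewrite (skew_ip skewB) // -ipC.
Qed.

End control_semigroup.

Theorem theorem2p4 (R : realType) (H : completeNormedModType R[i])
    (ip : {dot H for Num.conj}) (ip_norm : hilbert_norm ip)
    (delta : R) (delta_gt0 : 0 < delta)
    (A B : operator H) (phi : nat -> H) (lambda : nat -> R)
    (sys : discrete_spectrum_system ip A B phi)
    (ext : unique_extensions ip A B phi `]0, delta[)
    (eig : forall n, A (phi n) = ((lambda n) *i) *: phi n)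
    (indep : Q_linearly_independent (fun n => lambda n.+1 - lambda n))
    (coupled : forall n, ip (B (phi n)) (phi n.+1) != 0) :
  approximately_controllable ip A B phi `]0, delta[.
Proof.
move=> psi0 psi1 /(congr1 (@complex.Re R)) /= n0 /(congr1 (@complex.Re R)) /= n1 e e0.
have basis := phi_basis sys.
have S_id := @reachable_map_id R H ip delta A B phi.
have S_comp := @reachable_map_comp R H ip delta A B phi.
have S_isom := reachable_map_isometry ip_norm ext.
have rotations j (y : R[i]) : nm y = 1 ->
  tangent phi (reachable_map ip delta A B phi)
    (fun n => if n == j then y *: phi j.+1
              else if n == j.+1 then - conjc y *: phi j else 0).
  move=> y1; apply: (tangent_rotation ip_norm basis S_id S_comp S_isom
    (expop_drift_isometry ip_norm sys) (expop_drift_phi ip_norm sys eig)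
    (drift_approachable ip_norm delta_gt0 sys ext eig)
    (tangent_control ip_norm delta_gt0 sys ext eig)
    (lambda_injective indep) (@lambda_gap _ _ indep j) (control_skew sys) y1).
  exact: coupled.
have dU := half_delta delta_gt0.
(* The control must be nonempty: an arbitrary first step is applied to psi0, and its end point,
   again a unit vector, is then steered to psi1. *)
have h1 : nm (expop ip (perturbed ip A B phi (delta / 2)) 1 psi0) = 1.
  by rewrite (S_isom _ (reachable_map_step ip A B phi ltr01 dU)).2.
have e2 : 0 < e / 2 by rewrite divr_gt0.
have [W [s sU sW] Wpsi] :=
  reach_unit ip_norm basis S_id S_comp S_isom rotations h1 n1 e2.
exists ((1, delta / 2) :: s); split=> // [p|].
  by rewrite inE => /predU1P[->|/sU].
rewrite nmE ltcR /propagate /= -/(propagate _ _ _ _ s _) -sW nm_distC.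
by apply: le_lt_trans Wpsi _; rewrite ltr_pdivrMr // ltr_pMr // ltr1n.
Qed.
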